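(* Let $K$ be a field of characteristic zero, let $I$ be a graded Artinian ideal of $R=K[x_1,\ldots,x_n]$, and let $1\le k\le n$. Let $\operatorname{gin}(I)$ denote the generic initial ideal of $I$ with respect to the graded reverse lexicographic order. The following two conditions are equivalent: (i) $R/I$ has the $k$-WLP (resp. the $k$-SLP); (ii) $(R/\operatorname{gin}(I),x_n,x_{n-1},\ldots,x_{n-k+1})$ has the $k$-WLP (resp. the $k$-SLP).
   Context: $R$ has the standard grading; a graded (homogeneous) ideal $I$ is Artinian if $\dim_KR/I<\infty$. SLP/WLP: for a graded Artinian $K$-algebra $A=\bigoplus_iA_i$ and $\ell\in A_1$, $(A,\ell)$ has the SLP (resp. WLP) if the map $\times\ell^s:A_i\to A_{i+s}$ has full rank (is injective or surjective) for every $i\ge0$ and every $s>0$ (resp. for $s=1$). For $g_1,\ldots,g_k\in A_1$, $(A,g_1,\ldots,g_k)$ has the $k$-SLP (resp. $k$-WLP) if $(A,g_1)$ has the SLP (resp. WLP) and $(A/(g_1,\ldots,g_{i-1}),g_i)$ has the SLP (resp. WLP) for all $i=2,\ldots,k$. $A$ has the $k$-SLP (resp. $k$-WLP) if such $g_1,\ldots,g_k\in A_1$ exist. Graded reverse lexicographic order (with $x_1>\cdots>x_n$): $x^a>x^b$ if $\deg x^a>\deg x^b$, or the degrees are equal and the last nonzero entry of $a-b$ is negative. Generic initial ideal: for $g=(g_{ij})\in GL(n;K)$ let $g$ act on $R$ by $gx_j=\sum_ig_{ij}x_i$. There is a nonempty Zariski open $U\subset GL(n;K)$ such that the initial ideals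 of $g(I)$ coincide for all $g\in U$; this common initial ideal is $\operatorname{gin}(I)$. *)

(* Defs.v *)
From HB Require Import structures.
From mathcomp Require Import all_boot all_order all_algebra.
From mathcomp.multinomials Require Import mpoly.

Set Implicit Arguments.
Unset Strict Implicit.
Unset Printing Implicit Defensive.

Import GRing.Theory.
Local Open Scope ring_scope.

(* R = {mpoly K[n]}; the variable x_(i+1) is 'X_i, i : 'I_n.
   Ideals are Prop-valued predicates on R, and R itself is allowed as an ideal
   (the zero algebra occurs among the quotients A / (g_1, ..., g_(i-1))).
   An algebra R / J is handled through J: its elements are represented by
   polynomials, equality is congruence modulo J, and its component of degree d
   consists of the classes of the forms of degree d. *)

Section Ideals.
Variables (K : fieldType) (n : nat).
Local Notation R := {mpoly K[n]}.

Definition is_ideal (I : R -> Prop) : Prop :=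
  [/\ I 0, forall p q, I p -> I q -> I (p + q) & forall a p, I p -> I (a * p)].

Definition graded_ideal (I : R -> Prop) : Prop :=
  is_ideal I /\ forall d p, I p -> I (pihomog mdeg d p).

Definition congr_mod (I : R -> Prop) (p q : R) : Prop := I (p - q).

Definition ideal_gen (S : R -> Prop) (p : R) : Prop :=
  exists s : seq (R * R),
    (forall a, a \in s -> S a.2) /\ p = \sum_(a <- s) a.1 * a.2.

(* dim_K (R / I) is finite: the classes of the members of B span R / I. *)
Definition artinian (I : R -> Prop) : Prop :=
  exists B : seq R, forall p : R,
    exists c : 'I_(size B) -> K,
      congr_mod I p (\sum_(i < size B) c i *: B`_i).

End Ideals.

Section Lefschetz.
Variables (K : fieldType) (n : nat).
Local Notation R := {mpoly K[n]}.

(* Multiplication by f, from the degree i component of R / J to the degree j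
   component, is injective or surjective. *)
Definition full_rank (J : R -> Prop) (f : R) (i j : nat) : Prop :=
  (forall p q : R, p \is i.-homog -> q \is i.-homog ->
     congr_mod J (f * p) (f * q) -> congr_mod J p q)
  \/
  (forall q : R, q \is j.-homog ->
     exists2 p : R, p \is i.-homog & congr_mod J (f * p) q).

Definition WLP (J : R -> Prop) (l : R) : Prop :=
  l \is 1.-homog /\ forall i : nat, full_rank J l i i.+1.

Definition SLP (J : R -> Prop) (l : R) : Prop :=
  l \is 1.-homog /\
  forall i s : nat, (0 < s)%N -> full_rank J (l ^+ s) i (i + s).

(* (R / J) / (gs) is R / (J + (gs)); for gs = [::] this is J itself. *)
Definition ideal_add (J : R -> Prop) (gs : seq R) : R -> Prop :=
  ideal_gen (fun q => J q \/ q \in gs).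

Definition k_WLP (k : nat) (J : R -> Prop) (g : k.-tuple R) : Prop :=
  forall i : 'I_k, WLP (ideal_add J (take i g)) (tnth g i).

Definition k_SLP (k : nat) (J : R -> Prop) (g : k.-tuple R) : Prop :=
  forall i : 'I_k, SLP (ideal_add J (take i g)) (tnth g i).

Definition has_k_WLP (k : nat) (J : R -> Prop) : Prop :=
  exists g : k.-tuple R, k_WLP J g.

Definition has_k_SLP (k : nat) (J : R -> Prop) : Prop :=
  exists g : k.-tuple R, k_SLP J g.

(* The sequence x_n, x_(n-1), ..., x_(n-k+1). *)
Definition last_vars (k : nat) (hk : (k <= n)%N) : k.-tuple R :=
  [tuple 'X_(rev_ord (widen_ord hk j)) | j < k].

End Lefschetz.

Section GenericInitialIdeal.
Variables (K : fieldType) (n : nat).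
Local Notation R := {mpoly K[n]}.

(* Graded reverse lexicographic x^a > x^b. The order that the library puts on
   'X_{1..n} compares degrees and then exponents lexicographically from the
   first variable, so it is not this one. *)
Definition grevlex_gt (a b : 'X_{1..n}) : bool :=
  (mdeg b < mdeg a)%N ||
  ((mdeg a == mdeg b) &&
   [exists i : 'I_n, (a i < b i)%N &&
      [forall j : 'I_n, (i < j)%N ==> (a j == b j)]]).

Definition initial_monomial (f : R) (m : 'X_{1..n}) : Prop :=
  m \in msupp f /\
  forall m', m' \in msupp f -> m' != m -> grevlex_gt m m'.

Definition initial_ideal (J : R -> Prop) : R -> Prop :=
  ideal_gen (fun q =>
    exists (f : R) (m : 'X_{1..n}), [/\ J f, initial_monomial f m & q = 'X_[m]]).

(* The K-algebra endomorphism x_j |-> \sum_i g_ij x_i. *)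
Definition mx_act (g : 'M[K]_n) (p : R) : R :=
  p \mPo [tuple \sum_(i < n) g i j *: 'X_i | j < n].

Definition mx_act_ideal (g : 'M[K]_n) (I : R -> Prop) (q : R) : Prop :=
  exists2 p : R, I p & q = mx_act g p.

(* Zariski open subsets of GL(n; K): complements in GL(n; K) of the common zero
   set of a family S of polynomials in the n * n matrix entries. *)
Definition zariski_open_GL (U : 'M[K]_n -> Prop) : Prop :=
  exists S : {mpoly K[n * n]} -> Prop, forall g : 'M[K]_n,
    U g <-> g \in unitmx /\
            exists2 f : {mpoly K[n * n]}, S f & f.@[mxvec g 0] != 0.

(* J is the common initial ideal of the g(I), g ranging over some nonempty
   Zariski open subset of GL(n; K). Any two such subsets meet when K is
   infinite, so J is then unique up to pointwise equivalence. *)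
Definition is_gin (I J : R -> Prop) : Prop :=
  exists U : 'M[K]_n -> Prop,
    [/\ zariski_open_GL U, exists g, U g &
        forall g, U g -> forall p, initial_ideal (mx_act_ideal g I) p <-> J p].

End GenericInitialIdeal.

(* Main.v *)
Require Import Defs.
From HB Require Import structures.
From mathcomp Require Import all_boot all_order all_algebra perm.
From mathcomp Require Import boolp zify.
From mathcomp.multinomials Require Import mpoly.

Set Implicit Arguments.
Unset Strict Implicit.
Unset Printing Implicit Defensive.

Import GRing.Theory.
Local Open Scope ring_scope.

(* For grevlex, a monomial in which some of the last t variables occurs, or in
   which x_(n-t) occurs with exponent at least s, is smaller than every other
   monomial of the same degree. Hence taking initial ideals commutes with adding
   x_n, ..., x_(n-t+1) to a homogeneous ideal J and with the colon by
   x_(n-t)^s, so multiplication by x_(n-t)^s has full rank on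
   J + (x_n, ..., x_(n-t+1)) if and only if it has full rank on the initial
   ideal of J plus the same variables. In particular g(I) and gin(I) have the
   same Lefschetz properties along the last variables, which gives (ii) => (i).

   For (i) => (ii), a linear change of coordinates h turns the Lefschetz elements
   of I into the last variables; if they are linearly dependent, some quotient
   vanishes in degree 1 and the remaining ones may be chosen freely. For a set M
   of monomials closed downwards in each degree, the number of degree d monomials
   outside M in the initial ideal of g(I) is lower semicontinuous in g, so the
   Hilbert function of R / (gin(I) + M) is at most that of R / (in(h(I)) + M),
   with equality for empty M. Full rank is equivalent to the cokernel having the
   smallest size allowed by the Hilbert functions of source and target, so it
   passes from in(h(I)) to gin(I), by induction on the number of variables
   added. *)

(** * The graded reverse lexicographic order *)

Section Grevlex.
Variable n : nat.
Implicit Types (a b m : 'X_{1..n}) (v : 'I_n).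

Lemma grevlex_gtP a b : mdeg a = mdeg b ->
  reflect (exists2 i : 'I_n, (a i < b i)%N &
             forall j : 'I_n, (i < j)%N -> a j = b j)
          (grevlex_gt a b).
Proof.
move=> eqd; rewrite /grevlex_gt eqd ltnn eqxx /=; apply: (iffP existsP).
  move=> [i /andP[ltab /forallP eqab]]; exists i => // j ij.
  by apply/eqP/(implyP (eqab j)).
move=> [i ltab eqab]; exists i; rewrite ltab; apply/forallP => j.
by apply/implyP => /eqab/eqP.
Qed.

Lemma grevlex_irr m : grevlex_gt m m = false.
Proof. by apply/(grevlex_gtP (erefl _)) => -[i]; rewrite ltnn. Qed.

Lemma grevlex_mdeg a b : grevlex_gt a b -> (mdeg b <= mdeg a)%N.
Proof. by case/orP => [/ltnW|/andP[/eqP->]]. Qed.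

Lemma grevlex_trans b a c : grevlex_gt a b -> grevlex_gt b c -> grevlex_gt a c.
Proof.
move=> ab bc; have le1 := grevlex_mdeg ab; have le2 := grevlex_mdeg bc.
have [lt|le] := ltnP (mdeg c) (mdeg a); first by rewrite /grevlex_gt lt.
have eab : mdeg a = mdeg b by lia.
have ebc : mdeg b = mdeg c by lia.
case/(grevlex_gtP eab): ab => i lti eqi; case/(grevlex_gtP ebc): bc => j ltj eqj.
apply/grevlex_gtP; first by rewrite eab.
have [ij|ji|/val_inj eij] := ltngtP i j.
- exists j; first by rewrite eqi.
  by move=> l jl; rewrite eqi ?eqj //; apply: ltn_trans jl.
- exists i; first by rewrite -eqj.
  by move=> l il; rewrite eqi // eqj //; apply: ltn_trans il.
- exists i; first by apply: ltn_trans lti _; rewrite eij.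
  by move=> l il; rewrite eqi // eqj // -eij.
Qed.

Lemma grevlex_total a b : a != b -> grevlex_gt a b || grevlex_gt b a.
Proof.
move=> neq; have [lt|lt|eqd] := ltngtP (mdeg a) (mdeg b).
- by rewrite orbC /grevlex_gt lt.
- by rewrite /grevlex_gt lt.
have /existsP[i0 ni0] : [exists i, a i != b i].
  by apply: contraNT neq => /existsPn eqab; apply/eqP/mnmP => i; apply/eqP/negPn.
have [i ni max_i] := @arg_maxnP _ i0 (fun i => a i != b i) val ni0.
have eqi (j : 'I_n) : (i < j)%N -> a j = b j.
  by move=> ij; apply: contraTeq ij => /max_i; rewrite -leqNgt.
move: ni; rewrite neq_ltn => /orP[lt|lt]; apply/orP; [left|right].
  by apply/(grevlex_gtP eqd); exists i.
by apply/(grevlex_gtP (esym eqd)); exists i => // j /eqi.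
Qed.

Lemma grevlex_gtD c a b : grevlex_gt (a + c)%MM (b + c)%MM = grevlex_gt a b.
Proof.
rewrite /grevlex_gt !mdegD ltn_add2r eqn_add2r.
congr (_ || (_ && _)); apply: eq_existsb => i; rewrite !mnmDE ltn_add2r.
by congr (_ && _); apply: eq_forallb => j; rewrite !mnmDE eqn_add2r.
Qed.

Lemma grevlex_asym a b : grevlex_gt a b -> ~~ grevlex_gt b a.
Proof. by move=> ab; apply/negP => /(grevlex_trans ab); rewrite grevlex_irr. Qed.

Lemma grevlex_max (s : seq 'X_{1..n}) : s != [::] ->
  exists2 m, m \in s & forall m', m' \in s -> m' != m -> grevlex_gt m m'.
Proof.
elim: s => // a s IH _; have [->|/IH[m ms mmax]] := eqVneq s [::].
  by exists a => [|m']; rewrite mem_seq1 // => ->.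
have [eam|nam] := eqVneq a m.
  exists m => [|m']; rewrite inE ?ms ?orbT // => /orP[/eqP->|/mmax//].
  by rewrite eam eqxx.
case/orP: (grevlex_total nam) => gt.
  exists a => [|m']; rewrite inE ?eqxx // => /orP[->//|m's] _.
  by have [->//|/(mmax _ m's)] := eqVneq m' m; apply: grevlex_trans.
by exists m => [|m']; rewrite inE ?ms ?orbT // => /orP[/eqP->//|/mmax].
Qed.

(** There are finitely many monomials of degree [d], so one can induct on the number of those
    smaller than [m]. *)
Lemma grevlex_ind d (Q : 'X_{1..n} -> Prop) :
  (forall m, mdeg m = d ->
     (forall m', mdeg m' = d -> grevlex_gt m m' -> Q m') -> Q m) ->
  forall m, mdeg m = d -> Q m.
Proof.
move=> step m dm.
pose below m := [set x : 'X_{1..n < d.+1} | (mdeg x == d) && grevlex_gt m x].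
have [k] := ubnP #|below m|; elim: k m dm => // k IH m dm le_k.
apply: step => // m' dm' gt; apply: IH => //.
rewrite -ltnS; apply: leq_trans le_k; rewrite ltnS; apply/proper_card/properP; split.
  apply/subsetP => x; rewrite !inE => /andP[-> /=]; exact: grevlex_trans.
have bm' : (mdeg m' < d.+1)%N by rewrite dm'.
by exists (BMultinom bm'); rewrite !inE /= dm' eqxx //= grevlex_irr.
Qed.

(** For such [M], a form whose leading monomial lies in [M] is entirely supported on [M]. *)
Definition lower_set (M : pred 'X_{1..n}) : Prop :=
  forall a b, mdeg a = mdeg b -> grevlex_gt a b -> M a -> M b.

(** Indices start at 0: these are the monomials of the ideal generated by the ['X_i] with [c <= i],
    so there are none for [c = n]. *)
Definition tail (c : nat) : pred 'X_{1..n} :=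
  fun m => [exists i : 'I_n, (c <= i)%N && (0 < m i)%N].

(** The monomials of the ideal generated by ['X_v ^+ s] and the variables after [v]. *)
Definition tail_pow v (s : nat) : pred 'X_{1..n} :=
  fun m => tail v.+1 m || (s <= m v)%N.

Lemma tailPn c m :
  reflect (forall i : 'I_n, (c <= i)%N -> m i = 0%N) (~~ tail c m).
Proof.
apply: (iffP existsPn) => [h i ci|h i]; last first.
  by apply/negP => /andP[/h->].
by apply/eqP; move: (h i); rewrite ci lt0n negbK.
Qed.

Lemma tail_lower c : lower_set (tail c).
Proof.
move=> a b eqd /(grevlex_gtP eqd)[i lti eqi] /existsP[j /andP[cj aj]].
apply/existsP; have [ij|ji] := ltnP i j; first by exists j; rewrite cj -eqi.
by exists i; rewrite (leq_trans cj ji) (leq_ltn_trans _ lti).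
Qed.

Lemma tail_pow_lower v s : lower_set (tail_pow v s).
Proof.
move=> a b eqd gt /orP[/(tail_lower eqd gt)|av]; first by rewrite /tail_pow => ->.
case/(grevlex_gtP eqd): gt => i lti eqi; rewrite /tail_pow.
have [iv|vi|/val_inj eiv] := ltngtP i v.
- by rewrite -eqi // av orbT.
- apply/orP; left; apply/existsP; exists i.
  by rewrite vi (leq_ltn_trans _ lti).
- by apply/orP; right; rewrite -eiv (leq_trans _ (ltnW lti)) // eiv.
Qed.

Lemma tail_pow1 v m : tail_pow v 1 m = tail v m.
Proof.
apply/orP/existsP => [[/existsP[i /andP[vi mi]]|mv]|[i /andP[vi mi]]].
- by exists i; rewrite ltnW.
- by exists v; rewrite leqnn.
- move: vi; rewrite leq_eqVlt => /orP[/eqP/val_inj->|vi]; first by right.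
  by left; apply/existsP; exists i; rewrite vi.
Qed.

Lemma tailD c a b : tail c (a + b)%MM = tail c a || tail c b.
Proof.
apply/existsP/orP => [[i]|[/existsP[i]|/existsP[i]]].
- rewrite mnmDE addn_gt0 => /andP[ci /orP[h|h]]; [left|right];
    by apply/existsP; exists i; rewrite ci.
- by move=> /andP[ci h]; exists i; rewrite ci mnmDE addn_gt0 h.
- by move=> /andP[ci h]; exists i; rewrite ci mnmDE addn_gt0 h orbT.
Qed.

Lemma tailU c v s : (v < c)%N -> tail c (U_(v) *+ s)%MM = false.
Proof.
move=> vc; apply/negbTE/tailPn => i ci; rewrite mulmnE mnm1E.
by case: eqP => // evi; move: vc; rewrite evi ltnNge ci.
Qed.

Lemma mnmU_subK v s m : (s <= m v)%N -> (m - U_(v) *+ s + U_(v) *+ s)%MM = m.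
Proof.
move=> h; apply: submK; apply/mnm_lepP => i; rewrite mulmnE mnm1E.
by case: eqP => [<-|]; rewrite ?mul1n.
Qed.

Lemma mnmU_addE v s m : (m + U_(v) *+ s)%MM v = (m v + s)%N.
Proof. by rewrite mnmDE mulmnE mnm1E eqxx mul1n. Qed.

Lemma mdeg_addU v s m : mdeg (m + U_(v) *+ s)%MM = (mdeg m + s)%N.
Proof. by rewrite mdegD mdegMn mdeg1 mul1n. Qed.

End Grevlex.

(** * Leading monomials of graded ideals *)

Section Leading.
Variables (K : fieldType) (n : nat).
Local Notation R := {mpoly K[n]}.
Implicit Types (p q f : R) (m : 'X_{1..n}) (J : R -> Prop).

Definition restr (M : pred 'X_{1..n}) p : R :=
  \sum_(m <- msupp p | M m) p@_m *: 'X_[m].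

Lemma mcoeff_restr M p m : (restr M p)@_m = if M m then p@_m else 0.
Proof.
rewrite /restr raddf_sum /=.
under eq_bigr do rewrite mcoeffZ mcoeffX.
have [mp|mp] := boolP (m \in msupp p); last first.
  rewrite (memN_msupp_eq0 mp) if_same big_seq_cond big1 // => i /andP[ip _].
  case: eqP => [eim|_]; last by rewrite mulr0.
  by rewrite -eim ip in mp.
case: ifPn => Mm.
  rewrite big_mkcond (bigD1_seq m) ?msupp_uniq //= Mm eqxx mulr1.
  rewrite big1 ?addr0 // => i /negbTE nim; case: ifP => //.
  by rewrite nim mulr0.
rewrite big1 // => i Mi; case: eqP => [eim|]; last by rewrite mulr0.
by rewrite eim (negbTE Mm) in Mi.
Qed.

Lemma mcoeff_pihomog d p m :
  (pihomog mdeg d p)@_m = if mdeg m == d then p@_m else 0.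
Proof. exact: (mcoeff_restr (fun m => mdeg m == d)). Qed.

Lemma msupp_pihomog d p m :
  (m \in msupp (pihomog mdeg d p)) = (m \in msupp p) && (mdeg m == d).
Proof. by rewrite !mcoeff_msupp mcoeff_pihomog; case: ifP; rewrite ?eqxx ?andbT ?andbF. Qed.

Lemma dhomog_supp d p m : p \is d.-homog -> m \in msupp p -> mdeg m = d.
Proof. by move/dhomogP => h /h. Qed.

Lemma mdeg_homogX d m : (('X_[m] : R) \is d.-homog) = (mdeg m == d).
Proof. exact: dhomogX. Qed.

Lemma initial_monomialE f m : initial_monomial f m <->
  f@_m != 0 /\ forall m', f@_m' != 0 -> m' != m -> grevlex_gt m m'.
Proof.
rewrite /initial_monomial mcoeff_msupp; split=> -[h0 h]; split=> // m'.
  by rewrite -mcoeff_msupp; apply: h.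
by rewrite mcoeff_msupp; apply: h.
Qed.

Lemma initial_monomial_ex f : f != 0 -> exists m, initial_monomial f m.
Proof.
by rewrite -msupp_eq0 => /grevlex_max[m mf mmax]; exists m.
Qed.

Lemma initial_monomialX m : initial_monomial ('X_[m] : R) m.
Proof.
apply/initial_monomialE; split=> [|m']; rewrite mcoeffX ?eqxx ?oner_eq0 //.
by rewrite (eq_sym m) => + /negbTE nm; rewrite nm eqxx.
Qed.

Lemma initial_monomialMX f m m' :
  initial_monomial f m -> initial_monomial (f * 'X_[m']) (m + m')%MM.
Proof.
case=> mf mmax; split=> [|a].
  by rewrite (perm_mem (msuppMX _ _)) addmC map_f.
rewrite (perm_mem (msuppMX _ _)) => /mapP[b bf ->].
by rewrite addmC eqm_add2r grevlex_gtD; apply: mmax.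
Qed.

Lemma initial_monomial_homog d f m :
  f \is d.-homog -> initial_monomial f m -> mdeg m = d.
Proof. by move=> hf [/(dhomog_supp hf)]. Qed.

Definition subspace (P : R -> Prop) : Prop :=
  [/\ P 0, forall p q, P p -> P q -> P (p + q) & forall c p, P p -> P (c *: p)].

Lemma subspaceB P p q : subspace P -> P p -> P q -> P (p - q).
Proof. by case=> _ PD PZ Pp Pq; apply: PD; rewrite // -scaleN1r; apply: PZ. Qed.

Lemma subspace_sum P (I : Type) (r : seq I) (Q : pred I) (F : I -> R) :
  subspace P -> (forall i, Q i -> P (F i)) -> P (\sum_(i <- r | Q i) F i).
Proof. by case=> P0 PD _ h; apply: (big_ind P). Qed.

Lemma ideal_subspace J : is_ideal J -> subspace J.
Proof. by case=> J0 JD JM; split=> // c p; rewrite -mul_mpolyC; apply: JM. Qed.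

(** Subtracting from [f] a multiple of an element of [P'] with the same leading monomial leaves a
    remainder in [P] with a smaller one, so grevlex induction applies. *)
Lemma subspace_leading (P P' : R -> Prop) d :
    subspace P -> subspace P' -> (forall f, P' f -> P f) ->
    (forall f m, f \is d.-homog -> P f -> initial_monomial f m ->
       exists f', [/\ f' \is d.-homog, P' f' & initial_monomial f' m]) ->
  forall f, f \is d.-homog -> P f -> P' f.
Proof.
move=> sP sP' P'P lead.
have key : forall m, mdeg m = d -> forall f, f \is d.-homog -> P f ->
    initial_monomial f m -> P' f.
  apply: (@grevlex_ind n d) => m dm IH f hf Pf fm.
  have [f' [hf' P'f' f'm]] := lead f m hf Pf fm.
  have [nf' maxf'] := iffLR (initial_monomialE _ _) f'm.
  have [nf maxf] := iffLR (initial_monomialE _ _) fm.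
  pose g := f - (f@_m / f'@_m) *: f'.
  have hg : g \is d.-homog by rewrite rpredB ?rpredZ.
  have Pg : P g by apply: subspaceB => //; case: (sP) => _ _; apply; apply: P'P.
  have P'g : P' g.
    have [->|/initial_monomial_ex[m' gm']] := eqVneq g 0; first by case: sP'.
    have [ng _] := iffLR (initial_monomialE _ _) gm'.
    have nm'm : m' != m.
      apply: contraNneq ng => ->; rewrite mcoeffB mcoeffZ divfK ?subrr //.
    apply: (IH m' _ _ g) => //; first exact: initial_monomial_homog gm'.
    have [f0|/maxf->//] := eqVneq f@_m' 0.
    apply: maxf' => //; apply: contraNneq ng => f'0.
    by rewrite mcoeffB mcoeffZ f0 f'0 mulr0 subrr.
  rewrite -[f](subrK ((f@_m / f'@_m) *: f')).
  by case: sP' => _ PD PZ; apply: PD => //; apply: PZ.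
move=> f hf Pf; have [->|/initial_monomial_ex[m fm]] := eqVneq f 0.
  by case: sP'.
by apply: (key m) => //; exact: initial_monomial_homog fm.
Qed.

Definition LM J m : Prop := exists2 f, J f & initial_monomial f m.

(** The component of [f] in the degree of [m] still lies in [J] and is still led by [m]. *)
Lemma LM_homog J m : graded_ideal J -> LM J m ->
  exists f, [/\ f \is (mdeg m).-homog, J f & initial_monomial f m].
Proof.
case=> _ gJ [f Jf [mf mmax]]; exists (pihomog mdeg (mdeg m) f).
split; [exact: pihomogP | exact: gJ |].
split; first by rewrite msupp_pihomog mf eqxx.
by move=> m'; rewrite msupp_pihomog => /andP[/mmax].
Qed.

Lemma LM_D J m m' : is_ideal J -> LM J m -> LM J (m + m')%MM.
Proof.
case=> _ _ JM [f Jf fm]; exists (f * 'X_[m']); first by rewrite mulrC; apply: JM.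
exact: initial_monomialMX.
Qed.

Lemma ideal_gen_ideal (S : R -> Prop) : is_ideal (ideal_gen S).
Proof.
split; first by exists [::]; split=> //; rewrite big_nil.
  move=> p q [s [hs ->]] [t [ht ->]]; exists (s ++ t); split; last by rewrite big_cat.
  by move=> a; rewrite mem_cat => /orP[/hs|/ht].
move=> a p [s [hs ->]]; exists [seq (a * b.1, b.2) | b <- s]; split.
  by move=> _ /mapP[b /hs Sb ->].
by rewrite big_map mulr_sumr; apply: eq_bigr => i _; rewrite mulrA.
Qed.

Lemma ideal_gen_mem (S : R -> Prop) p : S p -> ideal_gen S p.
Proof.
move=> Sp; exists [:: (1, p)]; split; first by move=> a; rewrite inE => /eqP->.
by rewrite big_seq1 mul1r.
Qed.

Lemma ideal_gen_min (S I : R -> Prop) : is_ideal I -> (forall p, S p -> I p) ->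
  forall p, ideal_gen S p -> I p.
Proof.
move=> [I0 ID IM] SI p [s [hs ->]].
elim: s hs => [|a s IH] hs; first by rewrite big_nil.
rewrite big_cons; apply: ID; first by apply/IM/SI/hs; rewrite inE eqxx.
by apply: IH => b bs; apply: hs; rewrite inE bs orbT.
Qed.

Definition mono_ideal (G : 'X_{1..n} -> Prop) p : Prop :=
  forall m, m \in msupp p -> G m.

Lemma mono_ideal_graded (G : 'X_{1..n} -> Prop) :
  (forall m m', G m -> G (m + m')%MM) -> graded_ideal (mono_ideal G).
Proof.
move=> up; split; first split.
- by move=> m; rewrite msupp0.
- by move=> p q Gp Gq m /msuppD_le; rewrite mem_cat => /orP[/Gp|/Gq].
- move=> a p Gp m /msuppM_le/allpairsP[[m1 m2] /= [_ m2p ->]].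
  by rewrite addmC; apply/up/Gp.
- by move=> d p Gp m; rewrite msupp_pihomog => /andP[/Gp].
Qed.

Lemma LM_mono_ideal (G : 'X_{1..n} -> Prop) m : LM (mono_ideal G) m <-> G m.
Proof.
split=> [[f Gf [/Gf]//]|Gm]; exists 'X_[m]; last exact: initial_monomialX.
by move=> m'; rewrite msuppX inE => /eqP->.
Qed.

Lemma mpoly_supp_ideal (I : R -> Prop) p : is_ideal I ->
  (forall m, m \in msupp p -> I 'X_[m]) -> I p.
Proof.
move=> iI h; rewrite (mpolyE p) big_seq_cond.
apply: subspace_sum => [|m /andP[mp _]]; first exact: ideal_subspace.
by case: (ideal_subspace iI) => _ _; apply; apply: h.
Qed.

(** Leading monomials are stable under multiplication by monomials, so their span is already an
    ideal. From here on an initial ideal is handled as a set of monomials. *)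
Lemma initial_idealE J : is_ideal J -> initial_ideal J = mono_ideal (LM J).
Proof.
move=> iJ; apply/funext => p; apply/propext; split.
  apply: ideal_gen_min.
    by case: (@mono_ideal_graded (LM J)) => // m m'; apply: LM_D.
  move=> q [f [m [Jf fm ->]]] m'; rewrite msuppX inE => /eqP->.
  by exists f.
move=> h; apply: mpoly_supp_ideal => [|m /h[f Jf fm]]; first exact: ideal_gen_ideal.
by apply: ideal_gen_mem; exists f, m.
Qed.

Lemma initial_ideal_graded J : is_ideal J -> graded_ideal (initial_ideal J).
Proof.
by move=> iJ; rewrite initial_idealE //; apply: mono_ideal_graded => m m'; apply: LM_D.
Qed.

Lemma LM_initial_ideal J m : is_ideal J -> LM (initial_ideal J) m <-> LM J m.
Proof. by move=> iJ; rewrite initial_idealE //; apply: LM_mono_ideal. Qed.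

(** The sum of [J] and the ideal of the variables from index [c] on; the second summand is expressed
    by a support condition, which is easier to use than combinations of generators. *)
Definition add_tail J (c : nat) p : Prop :=
  exists2 j, J j & forall m, m \in msupp (p - j) -> tail c m.

Lemma add_tail_graded J c : graded_ideal J -> graded_ideal (add_tail J c).
Proof.
have [[T0 TD TM] gT] : graded_ideal (mono_ideal (fun m => tail c m)).
  by apply: mono_ideal_graded => m m'; rewrite tailD => ->.
move=> [[J0 JD JM] gJ]; split; first split.
- by exists 0 => //; rewrite subr0.
- move=> p q [j Jj pj] [i Ji qi]; exists (j + i); first exact: JD.
  by rewrite opprD addrACA; apply: TD.
- move=> a p [j Jj pj]; exists (a * j); first exact: JM.
  by rewrite -mulrBr; apply: TM.
- move=> d p [j Jj pj]; exists (pihomog mdeg d j); first exact: gJ.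
  by rewrite -pihomogB; apply: gT.
Qed.

Lemma add_tail_sub J c p : J p -> add_tail J c p.
Proof. by exists p => // m; rewrite subrr msupp0. Qed.

Lemma add_tail_supp J c p : is_ideal J ->
  (forall m, m \in msupp p -> tail c m) -> add_tail J c p.
Proof. by case=> J0 _ _ h; exists 0; rewrite ?subr0. Qed.

(** An element of the sum differs from one of [J] only at tail monomials, and these are smaller than
    the other monomials of their degree. A leading monomial outside the tail therefore already leads
    an element of [J]. *)
Lemma LM_add_tail J c m : graded_ideal J ->
  LM (add_tail J c) m <-> LM J m \/ tail c m.
Proof.
move=> gJ; split; last first.
  case=> [[f Jf fm]|tm]; first by exists f => //; apply: add_tail_sub.
  exists 'X_[m]; last exact: initial_monomialX.
  apply: add_tail_supp => [|m']; first by case: gJ.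
  by rewrite msuppX inE => /eqP->.
move=> /(LM_homog (add_tail_graded c gJ))[f [hf [j Jj fj] fm]].
have [tm|ntm] := boolP (tail c m); [by right | left].
have coe m' : mdeg m' = mdeg m -> ~~ tail c m' -> j@_m' = f@_m'.
  move=> dm' ntm'; apply/esym/eqP; rewrite -subr_eq0 -mcoeffB.
  by apply: contraNT ntm'; rewrite -mcoeff_msupp => /fj.
exists (pihomog mdeg (mdeg m) j); first by case: gJ => _; apply.
apply/initial_monomialE; case/initial_monomialE: fm => nf mmax; split.
  by rewrite mcoeff_pihomog eqxx coe.
move=> m'; rewrite mcoeff_pihomog; case: (mdeg m' =P mdeg m) => [dm'|]; last by rewrite eqxx.
move=> nj nm'm; have [tm'|ntm'] := boolP (tail c m').
  have /orP[gt|//] := grevlex_total nm'm.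
  by rewrite (tail_lower dm' gt tm') in ntm.
by apply: mmax nm'm; rewrite -coe.
Qed.

End Leading.

(** * Full rank in terms of leading monomials *)

Section FullRank.
Variables (K : fieldType) (n : nat).
Local Notation R := {mpoly K[n]}.
Implicit Types (p q f : R) (m : 'X_{1..n}) (J : R -> Prop) (v : 'I_n).

(** Injectivity or surjectivity of multiplication by ['X_v ^+ s] for a monomial ideal, read off on
    the monomials outside [G]. *)
Definition comb_full_rank (G : 'X_{1..n} -> Prop) v (s d : nat) : Prop :=
  (forall m, mdeg m = d -> G (m + U_(v) *+ s)%MM -> G m)
  \/ (forall m, mdeg m = (d + s)%N -> G m \/ (s <= m v)%N).

Lemma full_rank_comb J v s d :
    graded_ideal J -> (forall m, tail v.+1 m -> J 'X_[m]) ->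
  full_rank J ('X_v ^+ s) d (d + s) <-> comb_full_rank (LM J) v s d.
Proof.
move=> gJ tailJ; have [iJ _] := gJ; have [J0 JD JM] := iJ.
have sJ := ideal_subspace iJ.
have Xs : 'X_v ^+ s = 'X_[U_(v) *+ s] :> R by rewrite mpolyXn.
have LMtail m : tail v.+1 m -> LM J m.
  by move=> tm; exists 'X_[m]; [exact: tailJ | exact: initial_monomialX].
have homX p : p \is d.-homog -> p * 'X_[U_(v) *+ s] \is (d + s).-homog.
  by move=> hp; apply: dhomogM => //; rewrite mdeg_homogX mdegMn mdeg1 mul1n.
split=> -[inj|surj]; [left|right|left|right].
- move=> m dm /(LM_homog gJ)[f [hf Jf fm]].
  have [/LMtail//|ntm] := boolP (tail v.+1 m).
  (* Dropping the tail terms keeps [f] in [J] and keeps its leading monomial, which is outside the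
     tail by [ntm]. *)
  pose g := restr (predC (tail v.+1)) f.
  have gE a : g@_a = if tail v.+1 a then 0 else f@_a.
    by rewrite mcoeff_restr /=; case: (tail v.+1 a).
  have Jg : J g.
    rewrite -[g](subKr f); apply: subspaceB => //.
    apply: mpoly_supp_ideal => // a; rewrite mcoeff_msupp mcoeffB gE.
    by case: ifP => [/tailJ//|_]; rewrite subrr eqxx.
  have [nf maxf] := iffLR (initial_monomialE _ _) fm.
  have div a : a \in msupp g -> (s <= a v)%N.
    rewrite mcoeff_msupp gE; case: ifPn => [|nta nfa]; first by rewrite eqxx.
    have pow : tail_pow v s (m + U_(v) *+ s)%MM.
      by rewrite /tail_pow mnmU_addE leq_addl orbT.
    have [->|na] := eqVneq a (m + U_(v) *+ s)%MM; first by rewrite mnmU_addE leq_addl.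
    have da : mdeg (m + U_(v) *+ s)%MM = mdeg a.
      by rewrite (dhomog_supp hf) // mcoeff_msupp.
    have := tail_pow_lower da (maxf _ nfa na) pow.
    by rewrite /tail_pow (negbTE nta).
  (* The quotient of [g] by ['X_v ^+ s]: injectivity puts it in [J], and its leading monomial is
     [m]. *)
  pose h := \sum_(a <- msupp g) g@_a *: 'X_[(a - U_(v) *+ s)%MM] : R.
  have hX : h * 'X_[U_(v) *+ s] = g.
    rewrite mulr_suml [RHS](mpolyE g) big_seq [RHS]big_seq.
    apply: eq_bigr => a ag.
    by rewrite -scalerAl -mpolyXD mnmU_subK ?div.
  have hE a : h@_a = g@_(a + U_(v) *+ s)%MM by rewrite -hX addmC mcoeffMX.
  have hh : h \is d.-homog.
    apply/dhomogP => a; rewrite mcoeff_msupp hE gE; case: ifP; first by rewrite eqxx.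
    move=> _; rewrite -mcoeff_msupp => /(dhomog_supp hf).
    by rewrite !mdeg_addU dm => /addIn.
  exists h.
    rewrite -[h]subr0; apply: inj => //; first exact: rpred0.
    by rewrite /congr_mod mulr0 subr0 Xs mulrC hX.
  apply/initial_monomialE; split=> [|a].
    by rewrite hE gE tailD (negbTE ntm) tailU.
  rewrite hE gE; case: ifP => _; first by rewrite eqxx.
  by move=> nfa na; rewrite -(grevlex_gtD (U_(v) *+ s)%MM) maxf // eqm_add2r.
- move=> m dm; have [|ltms] := leqP s (m v); [by right | left].
  have hm : ('X_[m] : R) \is (d + s).-homog by rewrite mdeg_homogX dm.
  have [p hp Jp] := surj _ hm.
  have [/LMtail//|ntm] := boolP (tail v.+1 m).
  have powE a : (p * 'X_[U_(v) *+ s])@_a != 0 -> (s <= a v)%N.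
    rewrite -mcoeff_msupp (perm_mem (msuppMX _ _)) => /mapP[b _ ->].
    by rewrite addmC mnmU_addE leq_addl.
  (* Apart from [m], all monomials of this element of [J] are divisible by ['X_v ^+ s]; since [m] is
     outside [tail_pow v s], they are smaller than [m]. *)
  exists ('X_[m] - p * 'X_[U_(v) *+ s]).
    by rewrite -opprB -scaleN1r; case: sJ => _ _; apply; rewrite mulrC -Xs.
  apply/initial_monomialE; split=> [|a].
    rewrite mcoeffB mcoeffX eqxx; have [->|/powE] := eqVneq (p * 'X_[U_(v) *+ s])@_m 0.
      by rewrite subr0 oner_eq0.
    by rewrite leqNgt ltms.
  rewrite mcoeffB mcoeffX (eq_sym m) => + /[dup] na /negbTE nam.
  rewrite nam sub0r oppr_eq0 => npa.
  have da : mdeg a = mdeg m.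
    by rewrite dm (dhomog_supp (homX _ hp)) // mcoeff_msupp.
  have /orP[gt|//] := grevlex_total na.
  have := @tail_pow_lower _ v s _ _ da gt; rewrite /tail_pow powE // orbT => /(_ isT).
  by rewrite (negbTE ntm) leqNgt ltms.
- move=> p q hp hq; rewrite /congr_mod -mulrBr mulrC Xs.
  (* [P] is the colon of [J] by ['X_v ^+ s]; the hypothesis says that in degree [d] it has no
     leading monomials beyond those of [J]. *)
  pose P f := J (f * 'X_[U_(v) *+ s]).
  apply: (@subspace_leading _ _ P J d) => //.
  + rewrite /P; split=> [|a b Ja Jb|c a Ja]; first by rewrite mul0r.
      by rewrite mulrDl; apply: JD.
    by rewrite -scalerAl; case: sJ => _ _; apply.
  + by move=> f Jf; rewrite /P mulrC; apply: JM.
  + move=> f m hf Pf fm; have dm := initial_monomial_homog hf fm.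
    have /(LM_homog gJ)[f' [hf' Jf' f'm]] : LM J m.
      apply: inj => //; exists (f * 'X_[U_(v) *+ s]) => //.
      exact: initial_monomialMX.
    by exists f'; rewrite -dm.
  + exact: rpredB.
(* [P'] is the set of representatives of the image; it is enough that every monomial of degree
   [d + s] leads one of its forms. *)
- pose P' q := exists2 p, p \is d.-homog & J ('X_v ^+ s * p - q).
  move=> q hq; rewrite -/(P' q).
  apply: (@subspace_leading _ _ (fun _ => True) P' (d + s)) => //; last first.
    move=> f m hf _ fm; have dm := initial_monomial_homog hf fm.
    case: (surj _ dm) => [/(LM_homog gJ)[f' [hf' Jf' f'm]]|ms].
      exists f'; rewrite -dm; split=> //; exists 0; first exact: rpred0.
      by rewrite mulr0 sub0r -scaleN1r; case: sJ => _ _; apply.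
    exists 'X_[m]; split; [by rewrite mdeg_homogX dm | | exact: initial_monomialX].
    exists 'X_[(m - U_(v) *+ s)%MM].
      by rewrite mdeg_homogX -(eqn_add2r s) -dm -(mdeg_addU v) mnmU_subK.
    by rewrite Xs mulrC -mpolyXD mnmU_subK // subrr.
  split.
  + by exists 0; rewrite ?rpred0 // mulr0 subrr.
  + move=> a b [p hp Ja] [r hr Jb]; exists (p + r); first exact: rpredD.
    by rewrite mulrDr opprD addrACA; apply: JD.
  + move=> c a [p hp Ja]; exists (c *: p); first exact: rpredZ.
    by rewrite -scalerAr -scalerBr; case: sJ => _ _; apply.
Qed.

Lemma full_rank_add_tail J v s d : graded_ideal J ->
  full_rank (add_tail J v.+1) ('X_v ^+ s) d (d + s) <->
  comb_full_rank (fun m => LM J m \/ tail v.+1 m) v s d.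
Proof.
move=> gJ; have [iJ _] := gJ.
rewrite full_rank_comb.
- have -> // : LM (add_tail J v.+1) = (fun m => LM J m \/ tail v.+1 m).
  by apply/funext => m; apply/propext/LM_add_tail.
- exact: add_tail_graded.
- move=> m tm; apply: add_tail_supp => // m'.
  by rewrite msuppX inE => /eqP->.
Qed.

End FullRank.

(** * Lefschetz properties along the last variables *)

Section Lefschetz.
Variables (K : fieldType) (n : nat).
Local Notation R := {mpoly K[n]}.
Implicit Types (p q f : R) (m : 'X_{1..n}) (J : R -> Prop) (v : 'I_n).

(** The exponents to be tested form a parameter [S], so that one argument serves the weak and the
    strong property. *)
Definition lefschetz (S : pred nat) J (l : R) : Prop :=
  l \is 1.-homog /\ forall d s, S s -> full_rank J (l ^+ s) d (d + s).

Definition k_lefschetz (S : pred nat) k J (g : k.-tuple R) : Prop :=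
  forall i : 'I_k, lefschetz S (ideal_add J (take i g)) (tnth g i).

Lemma k_WLPE k J (g : k.-tuple R) : k_WLP J g <-> k_lefschetz (pred1 1%N) J g.
Proof.
split=> h i; have [hl fr] := h i; split=> // d.
  by move=> s /eqP->; rewrite addn1 expr1.
by have := fr d 1%N isT; rewrite addn1 expr1.
Qed.

Lemma k_SLPE k J (g : k.-tuple R) : k_SLP J g <-> k_lefschetz (fun s => 0 < s)%N J g.
Proof. by []. Qed.

Lemma ideal_gen_mono (S T : R -> Prop) : (forall p, S p -> T p) ->
  forall p, ideal_gen S p -> ideal_gen T p.
Proof.
move=> ST; apply: ideal_gen_min; first exact: ideal_gen_ideal.
by move=> p /ST; apply: ideal_gen_mem.
Qed.

Lemma ideal_add_ideal J (gs : seq R) : is_ideal (ideal_add J gs).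
Proof. exact: ideal_gen_ideal. Qed.

Lemma ideal_add_vars J (gs : seq R) c : is_ideal J ->
    (forall q, reflect (exists2 j : 'I_n, (c <= j)%N & q = 'X_j) (q \in gs)) ->
  ideal_add J gs = add_tail J c.
Proof.
move=> iJ gsP; have [J0 JD JM] := iJ; apply/funext => p; apply/propext; split.
  have iT : is_ideal (mono_ideal (K := K) (fun m => tail c m)).
    by case: (@mono_ideal_graded K n (tail c)) => // m m'; rewrite tailD => ->.
  apply: ideal_gen_min.
    split.
    - by apply: add_tail_sub.
    - move=> a b [j Jj aj] [i Ji bi]; exists (j + i); first exact: JD.
      by rewrite opprD addrACA; case: iT => _ TD _; apply: TD.
    - move=> a b [j Jj bj]; exists (a * j); first exact: JM.
      by rewrite -mulrBr; case: iT => _ _; apply.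
  move=> q [/add_tail_sub//|/gsP[j cj ->]]; apply: add_tail_supp => // m.
  rewrite msuppX inE => /eqP->; apply/existsP; exists j.
  by rewrite cj mnm1E eqxx.
move=> [j Jj pj]; rewrite -[p](subrK j).
case: (ideal_add_ideal J gs) => _ AD AM; apply: AD; last first.
  by apply: ideal_gen_mem; left.
apply: mpoly_supp_ideal => [|m /pj/existsP[i /andP[ci mi]]]; first exact: ideal_add_ideal.
rewrite -[m](@mnmU_subK _ i 1) // mpolyXD mulm1n; apply: AM.
by apply: ideal_gen_mem; right; apply/gsP; exists i.
Qed.

Lemma last_vars_takeP k (hk : (k <= n)%N) i q : (i <= k)%N ->
  reflect (exists2 j : 'I_n, (n - i <= j)%N & q = 'X_j) (q \in take i (last_vars K hk)).
Proof.
move=> ik; apply: (iffP (nthP 0)) => [[a]|[j nj ->]].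
  rewrite size_takel ?size_tuple // => ai; rewrite nth_take // => <-.
  have ak := leq_trans ai ik.
  exists (rev_ord (widen_ord hk (Ordinal ak))); first by rewrite /=; lia.
  by rewrite -(tnth_nth _ _ (Ordinal ak)) tnth_mktuple.
have jn := ltn_ord j; have jk : (n - j.+1 < k)%N by lia.
exists (n - j.+1)%N; first by rewrite size_takel ?size_tuple //; lia.
rewrite nth_take; last by lia.
rewrite -(tnth_nth _ _ (Ordinal jk)) tnth_mktuple; congr 'X_(_).
by apply: val_inj => /=; lia.
Qed.

(** At position [i] the variables of index at least [n - i] have been killed and the element is
    ['X_v] with [v.+1 = n - i], which is the situation of [full_rank_add_tail]. *)
Lemma k_lefschetz_last_vars S k (hk : (k <= n)%N) J : graded_ideal J ->
  k_lefschetz S J (last_vars K hk) <->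
  forall v, (n - k <= v)%N -> forall d s, S s ->
    comb_full_rank (fun m => LM J m \/ tail v.+1 m) v s d.
Proof.
move=> gJ; have [iJ _] := gJ.
have addE (i : 'I_k) : ideal_add J (take i (last_vars K hk)) = add_tail J (n - i).
  by apply: ideal_add_vars => // q; apply/last_vars_takeP/ltnW.
split=> [h v nv d s Ss|h i].
  have vn := ltn_ord v; have ik : (n - v.+1 < k)%N by lia.
  have [_ /(_ d s Ss)] := h (Ordinal ik).
  have eqv : rev_ord (widen_ord hk (Ordinal ik)) = v by apply: val_inj => /=; lia.
  have eqn : (n - Ordinal ik)%N = v.+1 by rewrite /=; lia.
  by rewrite addE tnth_mktuple eqv eqn => /(full_rank_add_tail _ _ _ gJ).
have ik := ltn_ord i; rewrite tnth_mktuple addE; set v := rev_ord _.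
split; first by rewrite mdeg_homogX mdeg1.
move=> d s Ss; have -> : (n - i)%N = v.+1 by rewrite /=; lia.
by apply/full_rank_add_tail => //; apply: h => //=; lia.
Qed.

End Lefschetz.

(** * Linear changes of coordinates *)

Section Action.
Variables (K : fieldType) (n : nat).
Local Notation R := {mpoly K[n]}.
Implicit Types (p q f : R) (m : 'X_{1..n}) (I J : R -> Prop) (g h : 'M[K]_n).

HB.instance Definition _ g := GRing.RMorphism.copy (mx_act g)
  (comp_mpoly [tuple \sum_(i < n) g i j *: 'X_i | j < n]).
HB.instance Definition _ g := GRing.Linear.copy (mx_act g)
  (comp_mpoly [tuple \sum_(i < n) g i j *: 'X_i | j < n]).

Lemma mx_actX g j : mx_act g 'X_j = \sum_(i < n) g i j *: 'X_i.
Proof. by rewrite /mx_act comp_mpolyXU -tnth_nth tnth_mktuple. Qed.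

Lemma mx_act_lin g (c : 'I_n -> K) :
  mx_act g (\sum_j c j *: 'X_j) = \sum_i (\sum_j g i j * c j) *: 'X_i.
Proof.
rewrite raddf_sum /=; under eq_bigr do rewrite linearZ /= mx_actX scaler_sumr.
rewrite exchange_big /=; apply: eq_bigr => i _.
by rewrite scaler_suml; apply: eq_bigr => j _; rewrite scalerA mulrC.
Qed.

Lemma rmorph_mpoly_ext (F G : {rmorphism R -> R}) :
  (forall c, F c%:MP = G c%:MP) -> (forall i, F 'X_i = G 'X_i) -> F =1 G.
Proof.
move=> FC FX p; rewrite (mpolyE p) !raddf_sum /=; apply: eq_bigr => m _.
rewrite -mul_mpolyC !rmorphM /= FC; congr (_ * _).
rewrite mpolyXE_id !rmorph_prod /=; apply: eq_bigr => i _.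
by rewrite !rmorphXn /= FX.
Qed.

Lemma mx_actC g c : mx_act g c%:MP = c%:MP.
Proof. exact: comp_mpolyC. Qed.

Lemma mx_act_mul g h p : mx_act g (mx_act h p) = mx_act (g *m h) p.
Proof.
apply: (@rmorph_mpoly_ext (mx_act g \o mx_act h) (mx_act (g *m h))) => [c|j] /=.
  by rewrite !mx_actC.
rewrite !mx_actX mx_act_lin; apply: eq_bigr => i _.
by rewrite mxE.
Qed.

Lemma mx_act1 p : mx_act 1%:M p = p.
Proof.
apply: (@rmorph_mpoly_ext (mx_act 1%:M) idfun) => [c|j] /=; first exact: mx_actC.
rewrite mx_actX (bigD1 j) //= big1 => [|i /negbTE nij].
  by rewrite mxE eqxx scale1r addr0.
by rewrite mxE nij scale0r.
Qed.

Lemma mx_actK g : g \in unitmx -> cancel (mx_act g) (mx_act (invmx g)).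
Proof. by move=> ug p; rewrite mx_act_mul mulVmx ?mx_act1. Qed.

Lemma mx_actVK g : g \in unitmx -> cancel (mx_act (invmx g)) (mx_act g).
Proof. by move=> ug p; rewrite mx_act_mul mulmxV ?mx_act1. Qed.

Lemma mx_act_homog g d p : p \is d.-homog -> mx_act g p \is d.-homog.
Proof.
move=> hp; rewrite /mx_act comp_mpolyE big_seq.
apply: rpred_sum => m /(dhomog_supp hp) <-; apply: rpredZ.
rewrite mdegE; elim/big_ind2: _ => [|a e b e'|i _]; first exact: dhomog1.
  exact: dhomogM.
rewrite tnth_mktuple; have lin : \sum_(j < n) g j i *: 'X_j \is 1.-homog.
  apply: rpred_sum => j _; apply: rpredZ.
  by have := mdeg_homogX K 1 U_(j); rewrite mdeg1.
by have := dhomogMn (m i) lin; rewrite mul1n.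
Qed.

Lemma pihomog_mx_act g d p :
  pihomog mdeg d (mx_act g p) = mx_act g (pihomog mdeg d p).
Proof.
rewrite /mx_act [in LHS]comp_mpolyEX [LHS]raddf_sum -/(mx_act g _).
rewrite [in RHS]pihomogE [RHS]raddf_sum [RHS]big_mkcond /=.
apply: eq_bigr => m _; rewrite !linearZ /=.
have hm : mx_act g 'X_[m] \is (mdeg m).-homog.
  by apply: mx_act_homog; rewrite mdeg_homogX.
case: eqP => [<-|/eqP ndm]; first by rewrite pihomog_dE.
by rewrite (pihomog_ne0 ndm hm) scaler0.
Qed.

Lemma mx_act_idealE g I : g \in unitmx ->
  mx_act_ideal g I = fun q => I (mx_act (invmx g) q).
Proof.
move=> ug; apply/funext => q; apply/propext; split=> [[p Ip ->]|Iq].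
  by rewrite mx_actK.
by exists (mx_act (invmx g) q); rewrite ?mx_actVK.
Qed.

Lemma mx_act_ideal_ideal g I : g \in unitmx -> is_ideal I ->
  is_ideal (mx_act_ideal g I).
Proof.
move=> ug [I0 ID IM]; rewrite mx_act_idealE //; split; first by rewrite rmorph0.
  by move=> p q Ip Iq; rewrite rmorphD; apply: ID.
by move=> a p Ip; rewrite rmorphM; apply: IM.
Qed.

Lemma mx_act_ideal_graded g I : g \in unitmx -> graded_ideal I ->
  graded_ideal (mx_act_ideal g I).
Proof.
move=> ug [iI gI]; split; first exact: mx_act_ideal_ideal.
move=> d p [q Iq ->]; exists (pihomog mdeg d q); first exact: gI.
exact: pihomog_mx_act.
Qed.

Lemma mx_act_idealK g I : g \in unitmx ->
  mx_act_ideal g (mx_act_ideal (invmx g) I) = I.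
Proof.
move=> ug; have uV : invmx g \in unitmx by rewrite unitmx_inv.
apply/funext => p; apply/propext; split=> [[_ [q Iq ->] ->]|Ip].
  by rewrite mx_actVK.
by exists (mx_act (invmx g) p); [exists p | rewrite mx_actVK].
Qed.

Lemma full_rank_mx_act g I f d e : g \in unitmx ->
  full_rank I f d e -> full_rank (mx_act_ideal g I) (mx_act g f) d e.
Proof.
move=> ug; rewrite /full_rank /congr_mod mx_act_idealE //.
have act := @mx_act_homog (invmx g).
move=> [inj|surj]; [left=> p q hp hq|right=> q hq].
  by rewrite !(rmorphB, rmorphM) /= mx_actK // => /inj; apply; exact: act.
have [p hp Ip] := surj _ (act _ _ hq).
exists (mx_act g p); first exact: mx_act_homog.
by rewrite !(rmorphB, rmorphM) /= !mx_actK.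
Qed.

Lemma ideal_add_mx_act g I (gs : seq R) : g \in unitmx ->
  mx_act_ideal g (ideal_add I gs) =
  ideal_add (mx_act_ideal g I) [seq mx_act g q | q <- gs].
Proof.
move=> ug; apply/funext => p; apply/propext; split.
  move=> [_ [s [hs ->]] ->].
  exists [seq (mx_act g a.1, mx_act g a.2) | a <- s]; split.
    move=> _ /mapP[a /hs h ->] /=; case: h => [Ia|ags]; [left|right].
      by exists a.2.
    exact: map_f.
  by rewrite big_map raddf_sum /=; apply: eq_bigr => a _; rewrite rmorphM.
apply: ideal_gen_min.
  by apply: mx_act_ideal_ideal => //; apply: ideal_add_ideal.
move=> q [[r Ir ->]|/mapP[r rgs ->]]; exists r => //; apply: ideal_gen_mem.
  by left.
by right.
Qed.

Lemma k_lefschetz_mx_act S k g I (l l' : k.-tuple R) : g \in unitmx ->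
    (forall i, tnth l' i = mx_act g (tnth l i)) ->
  k_lefschetz S I l -> k_lefschetz S (mx_act_ideal g I) l'.
Proof.
move=> ug l'E lef i; have [hl fr] := lef i; rewrite l'E.
have -> : l' = [tuple of [seq mx_act g q | q <- l]].
  by apply: eq_from_tnth => j; rewrite l'E tnth_map.
rewrite -map_take -ideal_add_mx_act //; split; first exact: mx_act_homog.
by move=> d s Ss; rewrite -rmorphXn; apply: full_rank_mx_act => //; apply: fr.
Qed.

End Action.

(** * Moving Lefschetz elements to the last variables *)

Section Coordinates.
Variables (K : fieldType) (n : nat).
Local Notation R := {mpoly K[n]}.
Implicit Types (p q f : R) (m : 'X_{1..n}) (I J : R -> Prop) (w a j : 'I_n).

Lemma linear_formE p : p \is 1.-homog -> p = \sum_j p@_U_(j) *: 'X_j.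
Proof.
move=> hp; apply/mpolyP => m; rewrite raddf_sum /=.
under eq_bigr do rewrite mcoeffZ mcoeffX.
have [/mdeg1P[i /eqP->]|nm] := boolP (mdeg m == 1%N).
  rewrite (bigD1 i) //= eqxx mulr1 big1 ?addr0 // => j /negbTE nji.
  by rewrite eq_mnm1 nji mulr0.
rewrite (dhomog_nemf_coeff hp nm) big1 // => j _.
by case: eqP => [ejm|]; rewrite ?mulr0 // -ejm mdeg1 eqxx in nm *.
Qed.

Lemma mx_act_tperm a b j : mx_act (tperm_mx a b : 'M[K]_n) 'X_j = 'X_(tperm a b j).
Proof.
rewrite mx_actX (bigD1 (tperm a b j)) //= !mxE tpermK eqxx scale1r.
rewrite big1 ?addr0 // => i ni; rewrite !mxE.
case: eqP => [eij|_]; last by rewrite scale0r.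
by rewrite -eij tpermK eqxx in ni.
Qed.

(** The matrix is the identity with column [w] replaced by [c], written as a rank one perturbation
    [1 + u e]. *)
Lemma elementary_mx (c : 'I_n -> K) w : c w != 0 ->
  exists2 Q : 'M[K]_n, Q \in unitmx &
    mx_act Q 'X_w = \sum_i c i *: 'X_i /\ forall j, j != w -> mx_act Q 'X_j = 'X_j.
Proof.
move=> cw; pose u : 'cV[K]_n := \col_i (c i - (i == w)%:R).
pose e : 'rV[K]_n := delta_mx 0 w.
have eu : e *m u = (c w - 1)%:M.
  rewrite -rowE; apply/matrixP => i j; rewrite !ord1 !mxE !eqxx.
  by rewrite mulr1n.
have QE i j : (1%:M + u *m e) i j = (i == j)%:R + (c i - (i == w)%:R) * (j == w)%:R.
  by rewrite !mxE big_ord1 !mxE eqxx.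
exists (1%:M + u *m e).
  (* The Sherman-Morrison inverse, as [1 + e u] is the scalar [c w]. *)
  suff : (1%:M + u *m e) *m (1%:M - (c w)^-1 *: (u *m e)) = 1%:M.
    by move/mulmx1_unit => [].
  rewrite mulmxDl mul1mx mulmxBr mulmx1 -scalemxAr mulmxA -(mulmxA u) eu.
  rewrite mul_mx_scalar -scalemxAl scalerA mulrBr mulVf // mulr1 scalerBl scale1r.
  by rewrite subKr subrK.
split=> [|j /negbTE jw]; rewrite mx_actX.
  by apply: eq_bigr => i _; rewrite QE eqxx mulr1 addrC subrK.
rewrite (bigD1 j) //= big1 => [|i /negbTE ij]; rewrite QE jw mulr0.
  by rewrite !addr0 eqxx scale1r.
by rewrite addr0 ij scale0r.
Qed.

(** Transposing [a] and [w] moves the nonzero coefficient to position [w] and fixes every index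
    beyond [w]. *)
Lemma elementary_mx_le (c : 'I_n -> K) a w : (a <= w)%N -> c a != 0 ->
  exists2 Q : 'M[K]_n, Q \in unitmx &
    mx_act Q 'X_w = \sum_i c i *: 'X_i /\
    forall j, (w < j)%N -> mx_act Q 'X_j = 'X_j.
Proof.
move=> aw ca; pose t := tperm a w.
have [|Q uQ [Qw Qj]] := @elementary_mx (fun i => c (t i)) w; first by rewrite tpermR.
exists (tperm_mx a w *m Q); first by rewrite unitmx_mul uQ unitmx_perm.
split=> [|j wj]; rewrite -mx_act_mul.
  rewrite Qw raddf_sum /= [RHS](reindex_inj (@perm_inj _ t)) /=.
  by apply: eq_bigr => i _; rewrite linearZ /= mx_act_tperm.
have njw : j != w by rewrite -val_eqE gtn_eqF.
rewrite Qj // mx_act_tperm tpermD // eq_sym // -val_eqE gtn_eqF //.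
exact: leq_ltn_trans wj.
Qed.

(** The quotient vanishes in positive degrees, so every map in question has zero target and is
    surjective. *)
Lemma lefschetz_trivial (S : pred nat) J l : (forall s, S s -> (0 < s)%N) ->
    is_ideal J -> (forall j, J 'X_j) -> l \is 1.-homog -> lefschetz S J l.
Proof.
move=> Spos iJ JX hl; split=> // d s /Spos s0; right=> q hq.
exists 0; first exact: rpred0.
rewrite /congr_mod mulr0; apply: subspaceB; first exact: ideal_subspace.
  by case: iJ.
apply: mpoly_supp_ideal => // m /(dhomog_supp hq) dm.
have /existsP[i mi] : [exists i, m i != 0%N].
  apply/existsPn => m0; have : mdeg m = 0%N.
    by rewrite mdegE big1 // => i _; apply/eqP/negPn/m0.
  by lia.
rewrite -[m](@mnmU_subK _ i 1) ?lt0n // mpolyXD mulm1n.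
by case: iJ => _ _; apply.
Qed.

Lemma ideal_add_mono J (gs hs : seq R) : {subset gs <= hs} ->
  forall p, ideal_add J gs p -> ideal_add J hs p.
Proof.
by move=> sub; apply: ideal_gen_mono => p [Jp|/sub]; [left | right].
Qed.

(** [P] is built one Lefschetz element at a time, until all are reached or one depends linearly on
    its predecessors. In that case the images under the current [P] serve as new Lefschetz
    elements. *)
Lemma k_lefschetz_coord (S : pred nat) k (hk : (k <= n)%N) I (l : k.-tuple R) :
    S 1%N -> (forall s, S s -> (0 < s)%N) -> k_lefschetz S I l ->
  exists2 P : 'M[K]_n, P \in unitmx &
    k_lefschetz S I [tuple mx_act P (tnth (last_vars K hk) j) | j < k].
Proof.
move=> S1 Spos lef; pose w (j : 'I_k) := rev_ord (widen_ord hk j).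
have lvE (j : 'I_k) : tnth (last_vars K hk) j = 'X_(w j) by rewrite tnth_mktuple.
pose img P := [tuple mx_act P (tnth (last_vars K hk) j) | j < k].
suff main i : (i <= k)%N ->
    (exists2 P, P \in unitmx & forall j : 'I_k, (j < i)%N -> mx_act P 'X_(w j) = tnth l j)
    \/ exists2 P : 'M[K]_n, P \in unitmx & k_lefschetz S I (img P).
  have [[P uP PE]|//] := main k (leqnn k).
  exists P => //; rewrite (_ : [tuple _ | j < k] = l) //.
  by apply: eq_from_tnth => j; rewrite tnth_mktuple lvE PE.
elim: i => [_|i IH ik]; first by left; exists 1%:M; rewrite ?unitmx1.
have [[P uP PE]|] := IH (ltnW ik); last by right.
pose i0 := Ordinal ik; have [hli fri] := lef i0.
pose c a := (mx_act (invmx P) (tnth l i0))@_U_(a).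
have liE : tnth l i0 = mx_act P (\sum_a c a *: 'X_a).
  by rewrite -linear_formE ?mx_actVK //; apply: mx_act_homog.
(* [P] already sends the variables after [w i0] to earlier Lefschetz elements. If the new one
   involves another variable, [P] can be extended; otherwise it lies in the span of the earlier
   ones. *)
have [/existsP[a /andP[aw ca]]|/existsPn c0] := boolP [exists a : 'I_n, (a <= w i0)%N && (c a != 0)].
  left; have [Q uQ [Qw Qj]] := elementary_mx_le aw ca.
  exists (P *m Q); first by rewrite unitmx_mul uP.
  move=> j; rewrite ltnS leq_eqVlt => /orP[/eqP ji|ji].
    have -> : j = i0 by apply: val_inj.
    by rewrite -mx_act_mul Qw liE.
  rewrite -mx_act_mul Qj ?PE //=.
  by have := ltn_ord j; lia.
right; exists P => //.
have takeE (j : nat) : (j <= i)%N -> take j (img P) = take j l.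
  move=> ji; have jk := leq_trans ji (ltnW ik).
  apply: (@eq_from_nth _ 0); rewrite !size_takel ?size_tuple // => b bj.
  have bk := leq_trans bj jk.
  rewrite !nth_take // -!(tnth_nth _ _ (Ordinal bk)) tnth_mktuple lvE PE //.
  exact: leq_trans ji.
set A := ideal_add I (take i l) in fri.
have iA : is_ideal A by apply: ideal_add_ideal.
have sA := ideal_subspace iA; have [A0 AD AM] := iA.
have Ali : A (tnth l i0).
  rewrite liE raddf_sum /=; apply: subspace_sum => // a _.
  have [->|ca] := eqVneq (c a) 0; first by rewrite scale0r raddf0.
  rewrite linearZ /=; case: sA => _ _; apply.
  have wa : (w i0 < a)%N.
    by rewrite ltnNge; apply: contraNN (c0 a) => ->.
  have an := ltn_ord a; have jk : (n - a.+1 < k)%N by move: wa => /=; lia.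
  have ji : (n - a.+1 < i)%N by move: wa => /=; lia.
  have -> : a = w (Ordinal jk) by apply: val_inj => /=; lia.
  rewrite PE //; apply: ideal_gen_mem; right.
  rewrite (tnth_nth 0) /= -(nth_take 0 ji) mem_nth // size_takel ?size_tuple //.
  exact: ltnW.
(* The new element is zero modulo [A], yet has full rank from degree 0 to degree 1: injectivity puts
   [1] in [A], surjectivity makes degree 1 vanish. *)
have AX a : A 'X_a.
  case: (fri 0%N 1%N S1) => [inj|surj].
    have A1 : A 1.
      rewrite -[1]subr0; apply: inj; [exact: dhomog1 | exact: rpred0 |].
      by rewrite /congr_mod expr1 mulr1 mulr0 subr0.
    by rewrite -[X in A X]mulr1; apply: AM.
  have [|p _ Ap] := surj 'X_a; first by rewrite mdeg_homogX mdeg1.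
  rewrite -(subKr (tnth l i0 ^+ 1 * p) 'X_a); apply: subspaceB => //.
  by rewrite expr1 mulrC; apply: AM.
(* Positions before [i] carry the original elements; from [i] on the quotient is zero in positive
   degrees and any linear form will do. *)
move=> j; have [ji|ij] := ltnP j i.
  rewrite takeE ?(ltnW ji) // tnth_mktuple lvE PE //; exact: lef.
apply: lefschetz_trivial => //; first exact: ideal_add_ideal.
  move=> a; apply: ideal_add_mono (AX a).
  by rewrite -takeE // -(subnKC ij) takeD => x xi; rewrite mem_cat xi.
rewrite tnth_mktuple lvE; apply: mx_act_homog.
by rewrite mdeg_homogX mdeg1.
Qed.

End Coordinates.

(** * Semicontinuity of initial ideals *)

Section PolyFun.
Variable K : fieldType.
Implicit Types (F G : K -> K).

(** Openness arguments are carried out along a line of matrices with parameter [t], so one-variable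
    polynomial functions suffice. *)
Definition polyfun F : Prop := exists P : {poly K}, forall t, F t = P.[t].

Lemma polyfun_cst c : polyfun (fun _ => c).
Proof. by exists c%:P => t; rewrite hornerC. Qed.

Lemma polyfunD F G : polyfun F -> polyfun G -> polyfun (fun t => F t + G t).
Proof. by move=> [P PE] [Q QE]; exists (P + Q) => t; rewrite hornerD PE QE. Qed.

Lemma polyfunM F G : polyfun F -> polyfun G -> polyfun (fun t => F t * G t).
Proof. by move=> [P PE] [Q QE]; exists (P * Q) => t; rewrite hornerM PE QE. Qed.

Lemma polyfun_sum (I : Type) (r : seq I) (P : pred I) (F : I -> K -> K) :
  (forall i, polyfun (F i)) -> polyfun (fun t => \sum_(i <- r | P i) F i t).
Proof.
move=> hF; elim: r => [|i r IH].
  by have [Q QE] := polyfun_cst 0; exists Q => t; rewrite big_nil.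
have [Q QE] := polyfunD (hF i) IH; have [Q' QE'] := IH.
case Pi : (P i); first by exists Q => t; rewrite big_cons Pi QE.
by exists Q' => t; rewrite big_cons Pi.
Qed.

Lemma polyfun_prod (I : Type) (r : seq I) (F : I -> K -> K) :
  (forall i, polyfun (F i)) -> polyfun (fun t => \prod_(i <- r) F i t).
Proof.
move=> hF; elim: r => [|i r IH].
  by have [Q QE] := polyfun_cst 1; exists Q => t; rewrite big_nil.
by have [Q QE] := polyfunM (hF i) IH; exists Q => t; rewrite big_cons.
Qed.

Lemma polyfunX F k : polyfun F -> polyfun (fun t => F t ^+ k).
Proof.
by move=> [P PE]; exists (P ^+ k) => t; rewrite horner_exp PE.
Qed.

Lemma polyfun_det r (A : K -> 'M[K]_r) :
  (forall i j, polyfun (fun t => A t i j)) -> polyfun (fun t => \det (A t)).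
Proof.
move=> hA; apply: polyfun_sum => s; apply: polyfunM; first exact: polyfun_cst.
exact: polyfun_prod.
Qed.

Lemma polyfun_meval k (v : K -> 'I_k -> K) (p : {mpoly K[k]}) :
  (forall i, polyfun (fun t => v t i)) -> polyfun (fun t => p.@[v t]).
Proof.
move=> hv; have [P PE] : polyfun (fun t => \sum_(m <- msupp p) p@_m * \prod_i v t i ^+ m i).
  apply: polyfun_sum => m; apply: polyfunM; first exact: polyfun_cst.
  by apply: polyfun_prod => i; apply: polyfunX.
by exists P => t; rewrite mevalE PE.
Qed.

Lemma polyfun_nonroot (hK : [pchar K] =i pred0) F G H a b c :
    polyfun F -> polyfun G -> polyfun H -> F a != 0 -> G b != 0 -> H c != 0 ->
  exists t, [/\ F t != 0, G t != 0 & H t != 0].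
Proof.
move=> [P PE] [Q QE] [T TE] Fa Gb Hc.
have nz (X : {poly K}) x : X.[x] != 0 -> X != 0.
  by apply: contraNneq => ->; rewrite horner0.
have PQT : P * Q * T != 0.
  by rewrite !mulf_neq0 // ?(nz P a) ?(nz Q b) ?(nz T c) -?PE -?QE -?TE.
(* These values are distinct in characteristic zero, and there is one more of them than the degree
   of the product, so they are not all roots. *)
pose rs := [seq i%:R | i <- iota 0 (size (P * Q * T))] : seq K.
have [/(max_poly_roots PQT)|/allPn[t _]] := boolP (all (root (P * Q * T)) rs).
  rewrite size_map size_iota ltnn map_inj_uniq ?iota_uniq => [/(_ isT)//|i j].
  wlog ij : i j / (i <= j)%N => [th|].
    by case/orP: (leq_total i j) => h /esym e; [|symmetry]; apply: th.
  move=> /esym/eqP; rewrite -subr_eq0 -natrB // => /eqP e0; apply/eqP.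
  have := (pcharf0P K).1 hK (j - i)%N.
  by rewrite e0 eqxx (eqn_leq i) ij /= -subn_eq0 => <-.
rewrite rootM rootM !negb_or -andbA !rootE -PE -QE -TE => /and3P[? ? ?].
by exists t.
Qed.

End PolyFun.

(** * Counting leading monomials along a family of matrices *)

Section Count.
Variables (K : fieldType) (n : nat).
Local Notation R := {mpoly K[n]}.
Implicit Types (p q f : R) (m : 'X_{1..n}) (I J : R -> Prop) (M : pred 'X_{1..n}).

(** For [G = LM J] with [J] graded and [M] closed downwards, this is the dimension of the degree [d]
    part of [J] modulo forms supported on [M]; the next two lemmas give the two inequalities. *)
Definition cnt (G : 'X_{1..n} -> Prop) M d : nat :=
  #|[set m : 'X_{1..n < d.+1} | [&& mdeg m == d, `[<G m>] & ~~ M m]]|.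

Lemma leading_count J M d r (f : 'I_r -> R) :
    graded_ideal J -> lower_set M ->
    (forall i, J (f i)) -> (forall i, f i \is d.-homog) ->
    (forall c : 'rV[K]_r,
       (forall m, mdeg m = d -> ~~ M m -> (\sum_i c 0 i *: f i)@_m = 0) -> c = 0) ->
  (r <= cnt (LM J) M d)%N.
Proof.
move=> [iJ _] lM Jf hf indep; rewrite /cnt; set S := [set m | _].
rewrite leqNgt; apply/negP => ltr.
pose mu (j : 'I_#|S|) : 'X_{1..n} := val (enum_val j).
pose A : 'M[K]_(r, #|S|) := \matrix_(i, j) (f i)@_(mu j).
(* More forms than counted monomials: some nontrivial combination [F] vanishes at all of these. Its
   leading monomial then lies in [M], which forces [F] to be supported on [M], against
   independence. *)
have : kermx A != 0.
  by rewrite kermx_eq0 /row_free ltn_eqF // (leq_ltn_trans (rank_leq_col _)).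
case/rowV0Pn => c /sub_kermxP cA c0; pose F := \sum_i c 0 i *: f i.
have FS (x : 'X_{1..n < d.+1}) (xS : x \in S) : F@_x = 0.
  move/rowP/(_ (enum_rank_in xS x)): cA; rewrite !mxE => <-.
  rewrite raddf_sum /=; apply: eq_bigr => i _.
  by rewrite mcoeffZ mxE /mu enum_rankK_in.
have hF : F \is d.-homog by apply: rpred_sum => i _; apply/rpredZ/hf.
have JF : J F.
  apply: subspace_sum => [|i _]; first exact: ideal_subspace.
  by case: (ideal_subspace iJ) => _ _; apply.
move/eqP: c0; apply; apply: indep => a da nMa; rewrite -/F.
apply/eqP/negPn/negP => Fa.
have [m Fm] : exists m, initial_monomial F m.
  by apply: initial_monomial_ex; apply: contraNneq Fa => ->; rewrite mcoeff0.
have dm := initial_monomial_homog hF Fm.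
have [nFm maxF] := iffLR (initial_monomialE _ _) Fm.
have bm : (mdeg m < d.+1)%N by rewrite dm.
have nMm : ~~ M m.
  have [<-//|am] := eqVneq a m.
  by apply: contraNN nMa; apply: lM; [rewrite dm | apply: maxF].
have /FS/= Fm0 : BMultinom bm \in S.
  by rewrite inE /= dm eqxx nMm andbT /=; apply/asboolP; exists F.
by rewrite Fm0 eqxx in nFm.
Qed.

(** Take one form per counted leading monomial; in grevlex order their coefficients at these
    monomials form a triangular matrix with nonzero diagonal. *)
Lemma leading_family J M d : graded_ideal J ->
  exists (f : 'I_(cnt (LM J) M d) -> R) (mu : 'I_(cnt (LM J) M d) -> 'X_{1..n}),
  [/\ forall i, J (f i), forall i, f i \is d.-homog,
      forall i, mdeg (mu i) = d /\ ~~ M (mu i) &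
      forall c : 'rV[K]_(cnt (LM J) M d),
        (forall j, (\sum_i c 0 i *: f i)@_(mu j) = 0) -> c = 0].
Proof.
move=> gJ; rewrite /cnt; set S := [set m | _].
have mS (i : 'I_#|S|) := enum_valP i.
have fex (i : 'I_#|S|) : exists f, [/\ f \is d.-homog, J f & initial_monomial f (val (enum_val i))].
  have := mS i; rewrite inE => /and3P[/eqP dm /asboolP/(LM_homog gJ)].
  by rewrite dm.
have [f fP] := choice fex.
exists f, (fun i => val (enum_val i)); split=> [i|i|i|c c0].
- by case: (fP i).
- by case: (fP i).
- by have := mS i; rewrite inE => /and3P[/eqP].
apply/eqP/negPn/negP => nzc.
(* The largest of these leading monomials occurs in no other form of the combination, so it cannot
   cancel. *)
pose s := [seq val (enum_val i) | i <- enum 'I_#|S| & c 0 i != 0].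
have [i ci] : exists i, c 0 i != 0.
  apply/existsP; apply: contraNT nzc => /existsPn zc.
  by apply/eqP/rowP => i; rewrite mxE; apply/eqP/negPn/zc.
have : s != [::].
  rewrite -size_eq0 size_map -lt0n -has_predT; apply/hasP; exists i => //.
  by rewrite mem_filter ci mem_enum.
case/grevlex_max => m /mapP[j]; rewrite mem_filter => /andP[cj _] -> maxj.
have := c0 j; rewrite raddf_sum /= (bigD1 j) //= big1 => [|l lj].
  rewrite addr0 mcoeffZ => /eqP; rewrite mulf_eq0 (negbTE cj) /=.
  by case: (fP j) => _ _ /initial_monomialE[/negbTE->].
have [cl|cl] := eqVneq (c 0 l) 0; first by rewrite cl scale0r mcoeff0.
have gt : grevlex_gt (val (enum_val j)) (val (enum_val l)).
  apply: maxj.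
    by apply/mapP; exists l => //; rewrite mem_filter cl mem_enum.
  by rewrite (inj_eq val_inj) (inj_eq enum_val_inj).
rewrite mcoeffZ; have [->|nz] := eqVneq (f l)@_(val (enum_val j)) 0; first by rewrite mulr0.
case: (fP l) => _ _ /initial_monomialE[_ /(_ _ nz)] gt'.
have := grevlex_asym gt; rewrite gt' //.
by apply: contraTneq gt => ->; rewrite grevlex_irr.
Qed.

(** With nothing discarded, the count is the dimension of the degree [d] part, which a change of
    coordinates preserves. Exchanging [g] and [h] gives equality. *)
Lemma cnt_mx_act I g h d : graded_ideal I -> g \in unitmx -> h \in unitmx ->
  (cnt (LM (mx_act_ideal g I)) pred0 d <= cnt (LM (mx_act_ideal h I)) pred0 d)%N.
Proof.
move=> gI ug uh; have gJ := mx_act_ideal_graded ug gI.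
have [f [mu [Jf hf _ indep]]] := leading_family pred0 d gJ.
pose k := h *m invmx g.
have uk : k \in unitmx by rewrite unitmx_mul uh unitmx_inv.
apply: (@leading_count _ _ _ _ (fun i => mx_act k (f i))) => // [|i|i|c c0].
- exact: mx_act_ideal_graded.
- have [p Ip ->] := Jf i; exists p => //.
  by rewrite mx_act_mul /k mulmxKV.
- exact: mx_act_homog.
apply: indep => j; suff -> : \sum_i c 0 i *: f i = 0 by rewrite mcoeff0.
apply: (can_inj (mx_actK uk)); rewrite raddf0 raddf_sum /=.
under eq_bigr do rewrite linearZ /=.
apply/mpolyP => m; rewrite mcoeff0; have [dm|ndm] := eqVneq (mdeg m) d; first exact: c0.
apply: (@dhomog_nemf_coeff _ _ mdeg d) ndm.
by apply: rpred_sum => i _; apply/rpredZ/mx_act_homog/hf.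
Qed.

Definition polyfam (p : K -> R) : Prop := forall m, polyfun (fun t => (p t)@_m).

Lemma polyfamM (p q : K -> R) : polyfam p -> polyfam q -> polyfam (fun t => p t * q t).
Proof.
move=> hp hq m.
have [P PE] : polyfun (fun t => \sum_(k : 'X_{1..n < (mdeg m).+1, (mdeg m).+1}
    | m == (k.1 + k.2)%MM) ((p t)@_k.1 * (q t)@_k.2)).
  by apply: polyfun_sum => k; apply: polyfunM.
by exists P => t; rewrite mcoeffM PE.
Qed.

Lemma polyfam_cst p : polyfam (fun _ => p).
Proof. by move=> m; apply: polyfun_cst. Qed.

Lemma polyfam_sum (T : Type) (r : seq T) (p : T -> K -> R) :
  (forall i, polyfam (p i)) -> polyfam (fun t => \sum_(i <- r) p i t).
Proof.
move=> hp m; have [P PE] := polyfun_sum r xpredT (fun i => hp i m).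
by exists P => t; rewrite raddf_sum PE.
Qed.

Lemma polyfam_prod (T : Type) (r : seq T) (p : T -> K -> R) :
  (forall i, polyfam (p i)) -> polyfam (fun t => \prod_(i <- r) p i t).
Proof.
move=> hp; elim: r => [|i r IH] m.
  by have [P PE] := polyfam_cst 1 m; exists P => t; rewrite big_nil.
by have [P PE] := polyfamM (hp i) IH m; exists P => t; rewrite big_cons.
Qed.

Lemma polyfamX (p : K -> R) k : polyfam p -> polyfam (fun t => p t ^+ k).
Proof.
move=> hp; elim: k => [|k IH] m; first exact: (polyfam_cst 1).
by have [P PE] := polyfamM hp IH m; exists P => t; rewrite exprS.
Qed.

Lemma polyfam_mx_act (A : K -> 'M[K]_n) p :
  (forall i j, polyfun (fun t => A t i j)) -> polyfam (fun t => mx_act (A t) p).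
Proof.
move=> hA m.
have [P PE] : polyfun (fun t => (\sum_(a <- msupp p) (p@_a)%:MP *
    \prod_(j < n) (\sum_(i < n) A t i j *: 'X_i) ^+ a j : R)@_m).
  apply: polyfam_sum => a; apply: polyfamM; first exact: polyfam_cst.
  apply: polyfam_prod => j; apply: polyfamX; apply: polyfam_sum => i b.
  have [Q QE] := polyfunM (hA i j) (polyfun_cst ('X_i : R)@_b).
  by exists Q => t; rewrite mcoeffZ QE.
exists P => t; rewrite -PE; congr mcoeff; rewrite /mx_act comp_mpolyE.
apply: eq_bigr => a _; rewrite mul_mpolyC; congr (_ *: _).
by apply: eq_bigr => j _; rewrite tnth_mktuple.
Qed.

(** Independence outside [M] of forms in [h(I)] is certified by a nonzero minor, and minors vary
    polynomially with the matrix. *)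
Lemma cnt_semicontinuous (hK : [pchar K] =i pred0) I h M d U :
    graded_ideal I -> lower_set M -> h \in unitmx ->
    zariski_open_GL U -> (exists g, U g) ->
  exists g, [/\ g \in unitmx, U g &
    cnt (LM (mx_act_ideal h I)) M d <= cnt (LM (mx_act_ideal g I)) M d]%N.
Proof.
move=> gI lM uh [S SE] [g0 /SE[ug0 [F SF Fg0]]].
have gJ := mx_act_ideal_graded uh gI.
have [f [mu [Jf hf muP indep]]] := leading_family M d gJ.
set r := cnt _ M d in f mu Jf hf muP indep *.
(* It suffices to find g on the line from h to a point g0 of U. *)
pose A t := h + t *: (g0 - h).
have A0 : A 0 = h by rewrite /A scale0r addr0.
have A1 : A 1 = g0 by rewrite /A scale1r addrC subrK.
have pA i j : polyfun (fun t => A t i j).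
  exists ((h i j)%:P + 'X * (g0 i j - h i j)%:P) => t.
  by rewrite !mxE hornerD hornerM !hornerC hornerX.
(* Pulled back to [I], the family can be moved by every [A t]; at [t = 0] it becomes [f] again. *)
pose p i := mx_act (invmx h) (f i).
have Ip i : I (p i) by have := Jf i; rewrite mx_act_idealE.
have hp i : p i \is d.-homog by apply: mx_act_homog.
pose C t : 'M[K]_r := \matrix_(i, j) (mx_act (A t) (p i))@_(mu j).
have CE t (c : 'rV[K]_r) j :
    (c *m C t) 0 j = (\sum_i c 0 i *: mx_act (A t) (p i))@_(mu j).
  by rewrite mxE raddf_sum; apply: eq_bigr => i _; rewrite mxE /= mcoeffZ.
have dC : \det (C 0) != 0.
  rewrite -unitfE -unitmxE -row_free_unit -kermx_eq0.
  apply/negPn/negP => /rowV0Pn[c /sub_kermxP cC]; apply/negP/negPn/eqP.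
  apply: indep => j; have := CE 0 c j; rewrite cC mxE A0 => /esym.
  by under eq_bigr do rewrite mx_actVK //.
have F1 : F.@[mxvec (A 1) 0] != 0 by rewrite A1.
have dA0 : \det (A 0) != 0 by rewrite A0 -unitfE -unitmxE.
(* The minor and [\det (A t)] are nonzero at [t = 0], where [A t] is [h]; the polynomial [F]
   witnessing [U g0] is nonzero at [t = 1]. *)
have [|||t [dCt Ft dAt]] := @polyfun_nonroot K hK (fun t => \det (C t))
  (fun t => F.@[mxvec (A t) 0]) (fun t => \det (A t)) 0 1 0 _ _ _ dC F1 dA0.
- apply: polyfun_det => i j; have [P PE] := polyfam_mx_act (p i) pA (mu j).
  by exists P => t; rewrite mxE PE.
- apply: polyfun_meval => i; case/mxvec_indexP: i => i j.
  by have [P PE] := pA i j; exists P => t; rewrite mxvecE PE.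
- exact: polyfun_det.
have uA : A t \in unitmx by rewrite unitmxE unitfE.
exists (A t); split=> //; first by apply/SE; split=> //; exists F.
apply: (@leading_count _ _ _ _ (fun i => mx_act (A t) (p i))) => // [|i|i|c c0].
- exact: mx_act_ideal_graded.
- by exists (p i).
- exact: mx_act_homog.
have uC : C t \in unitmx by rewrite unitmxE unitfE.
rewrite -[c](mulmxK uC) (_ : c *m C t = 0) ?mul0mx //.
apply/rowP => j; rewrite CE mxE; have [dmu nM] := muP j; exact: c0.
Qed.

End Count.

(** * Transfer by counting standard monomials *)

Section StandardMonomials.
Variable n : nat.
Implicit Types (G H : 'X_{1..n} -> Prop) (M : pred 'X_{1..n}) (v : 'I_n).

(** For [G] and [M] stable under multiplication by monomials, this is the Hilbert function of the
    quotient by the monomial ideal spanned by both. *)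
Definition std G M d : nat :=
  #|[set x : 'X_{1..n < d.+1} | [&& mdeg x == d, ~~ `[<G x>] & ~~ M x]]|.

(** The total does not depend on [G], so comparisons of [cnt] turn into reversed comparisons of
    [std]. *)
Lemma cntD_std G M d : (cnt G M d + std G M d)%N =
  #|[set x : 'X_{1..n < d.+1} | (mdeg x == d) && ~~ M x]|.
Proof.
rewrite -(cardsID [set x : 'X_{1..n < d.+1} | `[<G x>]]).
by congr (_ + _)%N; apply: eq_card => x; rewrite !inE;
  case: eqP => //=; case: `[<_>] => //=; rewrite ?andbT ?andbF.
Qed.

Lemma eq_std G M N d : (forall m, mdeg m = d -> M m = N m) -> std G M d = std G N d.
Proof.
move=> MN; apply: eq_card => x; rewrite !inE.
by case: eqP => //= /MN->.
Qed.

(** Rank and nullity of multiplication by ['X_v ^+ s] on standard monomials: the source is rank plus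
    kernel, the target is rank plus cokernel, and [tail_pow v s] counts the cokernel. *)
Lemma std_tail_pow G v s d : (forall m m', G m -> G (m + m')%MM) ->
  let GT m := G m \/ tail v.+1 m in
  (std G (tail v.+1) (d + s) <= std G (tail_pow v s) (d + s) + std G (tail v.+1) d)%N /\
  (comb_full_rank GT v s d <->
    (std G (tail_pow v s) (d + s) = 0 \/
     std G (tail v.+1) (d + s) = std G (tail_pow v s) (d + s) + std G (tail v.+1) d)%N).
Proof.
move=> upG GT; pose u : 'X_{1..n} := (U_(v) *+ s)%MM.
have tailu m : tail v.+1 (m + u)%MM = tail v.+1 m by rewrite tailD tailU ?orbF.
(* [lift_set] consists of the monomials with nonzero image and [lost_set], below, of the standard
   monomials in the kernel. *)
pose lift_set := [set x : 'X_{1..n < d.+1} |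
  [&& mdeg x == d, ~~ `[<G (x + u)%MM>] & ~~ tail v.+1 x]].
pose lost_set := [set x : 'X_{1..n < d.+1} |
  [&& mdeg x == d, ~~ `[<G x>], `[<G (x + u)%MM>] & ~~ tail v.+1 x]].
have fP (x : 'X_{1..n < d.+1}) : (mdeg (x + u)%MM < (d + s).+1)%N.
  by rewrite mdeg_addU ltnS leq_add2r -ltnS bmdeg.
pose f x : 'X_{1..n < (d + s).+1} := BMultinom (fP x).
have f_inj : injective f.
  by move=> x y /(congr1 val)/= /addIm/val_inj.
have split_top : std G (tail v.+1) (d + s) = (#|lift_set| + std G (tail_pow v s) (d + s))%N.
  rewrite /std -(cardsID [set x : 'X_{1..n < (d + s).+1} | (s <= x v)%N]); congr (_ + _)%N.
    rewrite -(card_imset _ f_inj); apply: eq_card => y; apply/idP/imsetP.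
      rewrite !inE => /andP[/and3P[dy Gy ty] sy].
      have yE := mnmU_subK sy.
      have {}dy : mdeg (y - u)%MM = d.
        by apply/eqP; rewrite -(eqn_add2r s) -(mdeg_addU v) yE.
      have bx : (mdeg (y - u)%MM < d.+1)%N.
        by rewrite dy.
      exists (BMultinom bx); last by apply: val_inj; rewrite /= yE.
      by rewrite inE /= dy eqxx yE Gy -tailu yE ty.
    move=> [x]; rewrite !inE => /and3P[/eqP dx Gx tx] ->.
    by rewrite /= mdeg_addU dx eqxx Gx tailu tx mnmU_addE leq_addl.
  by apply: eq_card => y; rewrite !inE /tail_pow negb_or; lia.
have split_bot : std G (tail v.+1) d = (#|lift_set| + #|lost_set|)%N.
  rewrite /std -(cardsID [set x : 'X_{1..n < d.+1} | ~~ `[<G (x + u)%MM>]]).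
  congr (_ + _)%N; apply: eq_card => x; rewrite !inE.
    case: (asboolP (G x)) => [/(upG _ u)/asboolP->|_]; rewrite ?andbF //=.
    by rewrite andbAC -andbA.
  by rewrite negbK; case: (mdeg x == d); case: `[<G x>] => //=; rewrite ?andbF // andbC.
have lostP : (forall m, mdeg m = d -> GT (m + u)%MM -> GT m) <-> #|lost_set| = 0%N.
  split=> [h|/eqP]; last first.
    rewrite cards_eq0 => /eqP lost0 m dm [Gmu|]; last by rewrite tailu; right.
    have [tm|ntm] := boolP (tail v.+1 m); first by right.
    have bm : (mdeg m < d.+1)%N by rewrite dm.
    have : BMultinom bm \notin lost_set by rewrite lost0 inE.
    by rewrite inE /= dm eqxx ntm (asboolT Gmu) /= andbT negbK => /asboolP; left.
  apply/eqP; rewrite cards_eq0; apply/eqP/setP => x; rewrite !inE.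
  apply/negP => /and4P[/eqP dx /asboolP nGx /asboolP Gxu ntx].
  by case: (h _ dx (or_introl Gxu)) => //; apply/negP.
have topP : (forall m, mdeg m = (d + s)%N -> GT m \/ (s <= m v)%N) <->
    std G (tail_pow v s) (d + s) = 0%N.
  split=> [h|/eqP]; last first.
    rewrite cards_eq0 => /eqP top0 m dm.
    have bm : (mdeg m < (d + s).+1)%N by rewrite dm.
    have : BMultinom bm \notin [set x : 'X_{1..n < (d + s).+1} |
      [&& mdeg x == (d + s)%N, ~~ `[<G x>] & ~~ tail_pow v s x]] by rewrite top0 inE.
    rewrite inE /= dm eqxx /= negb_and !negbK /tail_pow => /orP[/asboolP|/orP[]].
    - by left; left.
    - by left; right.
    - by right.
  apply/eqP; rewrite cards_eq0; apply/eqP/setP => x; rewrite !inE.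
  apply/negP => /and3P[/eqP dx /asboolP nGx]; rewrite /tail_pow negb_or => /andP[nt ns].
  by case: (h _ dx) => [[|]|]; [| apply/negP | apply/negP].
split; first by lia.
rewrite /comb_full_rank; split=> [[/lostP|/topP]|[/topP|h]]; [right|left|right|left] => //.
  by lia.
by apply/lostP; lia.
Qed.

(* For s = 1 the cokernels are the next quotients, so the equality of Hilbert
   functions propagates from the tail of t variables to that of t + 1. *)
Lemma comb_full_rank_transfer G H (S : pred nat) k :
    (forall m m', G m -> G (m + m')%MM) -> (forall m m', H m -> H (m + m')%MM) ->
    (forall M d, lower_set M -> std G M d <= std H M d)%N ->
    (forall d, std G pred0 d = std H pred0 d) -> S 1%N -> (k <= n)%N ->
    (forall v, (n - k <= v)%N -> forall d s, S s ->
       comb_full_rank (fun m => H m \/ tail v.+1 m) v s d) ->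
  forall v, (n - k <= v)%N -> forall d s, S s ->
    comb_full_rank (fun m => G m \/ tail v.+1 m) v s d.
Proof.
move=> upG upH leGH eq0 S1 kn combH.
have step v d s : (forall e, std G (tail v.+1) e = std H (tail v.+1) e) ->
    comb_full_rank (fun m => H m \/ tail v.+1 m) v s d ->
  comb_full_rank (fun m => G m \/ tail v.+1 m) v s d /\
  std G (tail_pow v s) (d + s) = std H (tail_pow v s) (d + s).
  (* The cokernel for [G] is at most the one for [H], and at least the excess of target over source.
     Full rank for [H] means its cokernel is zero or equal to this excess, so the two cokernels
     agree. *)
  move=> eqt; have [_ ->] := std_tail_pow v s d upH.
  have [le ->] := std_tail_pow v s d upG.
  have := leGH _ (d + s)%N (@tail_pow_lower n v s).
  by move: le; rewrite !eqt; lia.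
have eqtail t : (t <= k)%N -> forall d, std G (tail (n - t)) d = std H (tail (n - t)) d.
  elim: t => [_ d|t IH tk d].
    have tail0 (m : 'X_{1..n}) : mdeg m = d -> tail (n - 0) m = pred0 m.
      by move=> _; apply/negbTE/tailPn => i; have := ltn_ord i; lia.
    by rewrite !(eq_std _ tail0).
  have tn : (n - t.+1 < n)%N by lia.
  pose v := Ordinal tn; have vE : (n - t)%N = v.+1 by rewrite /=; lia.
  rewrite -[(n - t.+1)%N]/(val v).
  have {IH} := IH (ltnW tk); rewrite vE => eqv.
  (* Only positive degrees arise as cokernels of multiplication by ['X_v]; in degree 0 both tails
     miss the monomial 1. *)
  case: d => [|d].
    have tail0 (m : 'X_{1..n}) : mdeg m = 0%N -> tail v m = tail v.+1 m.
      move/eqP; rewrite mdeg_eq0 => /eqP->.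
      by apply/idP/idP => /existsP[i]; rewrite mnm0E andbF.
    by rewrite !(eq_std _ tail0).
  have tailE (m : 'X_{1..n}) : mdeg m = d.+1 -> tail v m = tail_pow v 1 m by rewrite tail_pow1.
  rewrite !(eq_std _ tailE) -[d.+1]addn1.
  have nv : (n - k <= v)%N by rewrite /=; lia.
  by have [_ ->] := step v d 1%N eqv (combH v nv d 1%N S1).
move=> v nv d s Ss; have vn := ltn_ord v.
have eqv e : std G (tail v.+1) e = std H (tail v.+1) e.
  by rewrite -[v.+1](@subKn _ n) //; apply: eqtail; lia.
by have [] := step v d s eqv (combH v nv d s Ss).
Qed.

End StandardMonomials.

(** * Comparison of an ideal with its generic initial ideal *)

Section Main.
Variables (K : fieldType) (n : nat).
Local Notation R := {mpoly K[n]}.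

Lemma has_k_lefschetz_gin (hK : [pchar K] =i pred0) (S : pred nat) k
    (hkn : (k <= n)%N) (I ginI : R -> Prop) :
    S 1%N -> (forall s, S s -> (0 < s)%N) -> graded_ideal I -> is_gin I ginI ->
  (exists g : k.-tuple R, k_lefschetz S I g) <->
  k_lefschetz S ginI (last_vars K hkn).
Proof.
move=> S1 Spos gI [U [openU exU ginE]].
have unitU g : U g -> g \in unitmx by case: openU => T TE /TE[].
have ginP g : U g -> ginI = initial_ideal (mx_act_ideal g I).
  by move=> Ug; apply/funext => p; apply/propext; rewrite ginE.
have LMgin g : U g -> LM ginI = LM (mx_act_ideal g I).
  move=> Ug; rewrite (ginP g Ug); apply/funext => m; apply/propext.
  by apply/LM_initial_ideal/mx_act_ideal_ideal; [exact: unitU | case: gI].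
have [g Ug] := exU; have ug := unitU g Ug.
have gJ := mx_act_ideal_graded ug gI.
have ggin : graded_ideal ginI.
  by rewrite (ginP g Ug); apply: initial_ideal_graded; case: gJ.
split=> [[l lef]|].
  have [P uP lefP] := k_lefschetz_coord hkn S1 Spos lef.
  (* [P] sends the last variables to Lefschetz elements of [I], so the last variables are Lefschetz
     for [h(I)]. *)
  pose h := invmx P; have uh : h \in unitmx by rewrite unitmx_inv.
  have gH := mx_act_ideal_graded uh gI.
  have : k_lefschetz S (mx_act_ideal h I) (last_vars K hkn).
    apply: k_lefschetz_mx_act lefP => // i.
    by rewrite [X in mx_act h X]tnth_mktuple mx_actK.
  move=> /(k_lefschetz_last_vars _ _ gH) combH.
  apply/(k_lefschetz_last_vars _ _ ggin).
  apply: comb_full_rank_transfer combH => //.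
  - by move=> m m'; apply: LM_D; case: ggin.
  - by move=> m m'; apply: LM_D; case: gH.
  (* The matrix [g'] depends on [M] and [d], but every matrix in [U] gives the same initial
     ideal. *)
  - move=> M d lM; have [g' [ug' Ug']] := cnt_semicontinuous hK d gI lM uh openU exU.
    rewrite -(LMgin g' Ug').
    have := cntD_std (LM ginI) M d; rewrite -(cntD_std (LM (mx_act_ideal h I)) M d).
    by lia.
  - move=> d; rewrite (LMgin g Ug).
    have := cntD_std (LM (mx_act_ideal g I)) pred0 d.
    rewrite -(cntD_std (LM (mx_act_ideal h I)) pred0 d).
    have := cnt_mx_act d gI ug uh; have := cnt_mx_act d gI uh ug.
    by lia.
(* For the converse a single [g] in [U] suffices: [g(I)] and [ginI] share their leading monomials,
   and the inverse of [g] carries the last variables to Lefschetz elements of [I]. *)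
move=> /(k_lefschetz_last_vars _ _ ggin); rewrite (LMgin g Ug).
move=> /(k_lefschetz_last_vars _ hkn gJ) lef.
have uV : invmx g \in unitmx by rewrite unitmx_inv.
exists [tuple mx_act (invmx g) (tnth (last_vars K hkn) i) | i < k].
rewrite -(mx_act_idealK I uV) invmxK; apply: k_lefschetz_mx_act lef => // i.
by rewrite tnth_mktuple.
Qed.

End Main.

Theorem proposition26 (K : fieldType) (hK : [pchar K] =i pred0)
    (n k : nat) (hk1 : (1 <= k)%N) (hkn : (k <= n)%N)
    (I : {mpoly K[n]} -> Prop) (hI : graded_ideal I) (hA : artinian I)
    (ginI : {mpoly K[n]} -> Prop) (hgin : is_gin I ginI) :
  (has_k_WLP k I <-> k_WLP ginI (last_vars K hkn)) /\
  (has_k_SLP k I <-> k_SLP ginI (last_vars K hkn)).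
Proof.
have lefE S := has_k_lefschetz_gin hK (S := S) hkn.
split.
  rewrite k_WLPE -(lefE _ I) // => [|s /eqP->//].
  by split=> -[g /k_WLPE]; exists g => //; apply/k_WLPE.
by rewrite k_SLPE -(lefE _ I).
Qed.
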